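(* Let $E/F$ be an unramified cubic field extension of non-Archimedean local fields and let $R$ be an order of $E$. Let $s=S(R)$ and let $f=f(R)$ be the conductor exponent of $R$. Then $\#\overline{\mathrm{Cl}}(R)$ depends only on $s$, $f$ and $q$, and $$\#\overline{\mathrm{Cl}}(R)=\begin{cases} \dfrac{q^{\frac s2+2}+7q^{\frac s2+1}+4q^{\frac s2}+(2s-2)q^{\frac f2}(1-q)-8q^{\frac f2+1}-3q^{s-f+1}-q^{s-f}}{q^{\frac f2}(q-1)^2} & s \text{ even},\ f\text{ even};\\[1.2em] \dfrac{4q^{\frac s2+1}+7q^{\frac s2}+q^{\frac s2-1}+(2s-2)q^{\frac{f-1}2}(1-q)-8q^{\frac{f+1}2}-q^{s-f+1}-3q^{s-f}}{q^{\frac{f-1}2}(q-1)^2} & s\text{ even},\ f\text{ odd};\\[1.2em] \dfrac{4q^{\frac{s+3}2}+7q^{\frac{s+1}2}+q^{\frac{s-1}2}+(2s-2)q^{\frac f2}(1-q)-8q^{\frac f2+1}-3q^{s-f+1}-q^{s-f}}{q^{\frac f2}(q-1)^2} & s\text{ odd},\ f\text{ even};\\[1.2em] \dfrac{q^{\frac{s+3}2}+7q^{\frac{s+1}2}+4q^{\frac{s-1}2}+(2s-2)q^{\frac{f-1}2}(1-q)-8q^{\frac{f+1}2}-q^{s-f+1}-3q^{s-f}}{q^{\frac{f-1}2}(q-1)^2} & s\text{ odd},\ f\text{ odd}. \end{cases}$$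
   Context: $F$ is a non-Archimedean local field of any characteristic, with ring of integers $\mathfrak o$, uniformizer $\pi$, and residue field of cardinality $q$. $\mathcal O_E$ is the ring of integers of $E$. An order of $E$ is a subring $\mathcal O\subset E$ containing $\mathfrak o$, finitely generated as an $\mathfrak o$-module, with $F\mathcal O=E$. $S(R)$ is the length of $\mathcal O_E/R$ as an $\mathfrak o$-module. The conductor exponent $f(R)\ge0$ is defined by $\{a\in\mathcal O_E: a\mathcal O_E\subset R\}=\pi^{f(R)}\mathcal O_E$. A fractional $R$-ideal is a nonzero finitely generated $R$-submodule of $E$; $\overline{\mathrm{Cl}}(R)$ is the set (monoid) of fractional $R$-ideals modulo multiplication by $E^\times$. *)

(* Defs.v *)
From mathcomp Require Import all_boot all_order all_algebra all_field.
From mathcomp Require Import all_classical.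

Set Implicit Arguments.
Unset Strict Implicit.
Unset Printing Implicit Defensive.

Import Order.TTheory GRing.Theory Num.Theory.
Local Open Scope classical_set_scope.
Local Open Scope card_scope.
Local Open Scope ring_scope.

Section LocalField.
Variables (F : fieldType) (v : F -> int).

(* v stands for a valuation F -> Z \cup {+oo} with v 0 = +oo: its value at 0 is
   junk and is never used, every "n <= v x" being written vge n x. *)
Definition vge (n : int) : {pred F} := [pred x | (x == 0) || (n <= v x)].

Definition valuation_ring : {pred F} := vge 0.

Definition uniformizer (pi : F) : Prop := pi != 0 /\ v pi = 1.

Definition v_cauchy (u : nat -> F) : Prop :=
  forall N : int, exists n0 : nat, forall m n : nat,
    (n0 <= m)%N -> (n0 <= n)%N -> u m - u n \in vge N.

Definition v_converges (u : nat -> F) (l : F) : Prop :=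
  forall N : int, exists n0 : nat, forall n : nat,
    (n0 <= n)%N -> u n - l \in vge N.

Definition cosets (V : zmodType) (A B : set V) : set (set V) :=
  [set [set x + y | y in B] | x in A].

(* Non-Archimedean local field with normalized valuation v and residue field of
   cardinality q: complete discretely valued, with finite residue field. *)
Record local_field (q : nat) : Prop := LocalField {
  valM : forall x y, x != 0 -> y != 0 -> v (x * y) = v x + v y;
  valD : forall n x y, x \in vge n -> y \in vge n -> x + y \in vge n;
  val_normalized : exists pi, uniformizer pi;
  val_complete : forall u, v_cauchy u -> exists l, v_converges u l;
  residue_card : cosets [set` valuation_ring] [set` vge 1] #= `I_q
}.

End LocalField.

Section Submodules.
Variable E : fieldType.
Implicit Types A B I J M : set E.

Definition subring A : Prop :=
  [/\ A 1, forall x y, A x -> A y -> A (x - y)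
         & forall x y, A x -> A y -> A (x * y)].

Definition submodule A M : Prop :=
  [/\ M 0, forall x y, M x -> M y -> M (x + y)
         & forall a x, A a -> M x -> M (a * x)].

(* Finite sums of products a * b with a in A and b in B *)
Definition mulset A B : set E :=
  [set x | exists n (a b : 'I_n -> E),
    [/\ forall i, A (a i), forall i, B (b i) & x = \sum_(i < n) a i * b i]].

Definition finitely_generated A M : Prop :=
  exists gens : seq E, M = mulset A [set` gens].

Definition scale_set (a : E) M : set E := [set a * x | x in M].

(* Strict chains of A-modules B = L 0 < L 1 < ... < L n = C; these correspond
   to the strict chains of length n from 0 to C / B in the A-module C / B. *)
Definition strict_chain A B (C : set E) (n : nat) (L : nat -> set E) : Prop :=
  [/\ L 0%N = B, L n = C,
      forall i, (i <= n)%N -> submodule A (L i)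
    & forall i, (i < n)%N -> L i `<` L i.+1].

(* The A-module C / B has (finite) length n *)
Definition quotient_length A B (C : set E) (n : nat) : Prop :=
  (exists L : nat -> set E, strict_chain A B C n L) /\
  (forall m (L : nat -> set E), strict_chain A B C m L -> (m <= n)%N).

Definition fractional_ideal A I : Prop :=
  [/\ submodule A I, finitely_generated A I & I <> [set 0]].

Definition ideal_class A I : set (set E) :=
  [set J | fractional_ideal A J /\ exists2 a, a != 0 & J = scale_set a I].

(* Fractional ideals modulo multiplication by nonzero elements of E; for an
   order A of E all the nonzero fractional ideals count, invertible or not. *)
Definition ideal_class_monoid A : set (set (set E)) :=
  [set ideal_class A I | I in fractional_ideal A].

End Submodules.

Section Extension.
Variables (F : fieldType) (v : F -> int) (E : fieldExtType F).

Definition base_field : set E := [set c%:A | c in [set: F]].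

Definition base_integers : set E := [set c%:A | c in [set` valuation_ring v]].

(* The integral closure of the valuation ring of F in E *)
Definition integers : set E :=
  [set x | exists p : {poly F},
    [/\ p \is monic, p \is a polyOver (valuation_ring v)
      & root (map_poly (in_alg E) p) x]].

(* The maximal ideal of the ring of integers of E (its set of non-units) is
   generated by the uniformizer pi of F, i.e. the ramification index is 1; the
   residue field extension is separable since the residue field of F is
   finite. *)
Definition unramified (pi : F) : Prop :=
  [set x | integers x /\ ~ exists2 y, integers y & x * y = 1] =
  scale_set pi%:A integers.

Definition is_order (R : set E) : Prop :=
  [/\ subring R, base_integers `<=` R, finitely_generated base_integers R
    & mulset base_field R = [set: E]].

Definition colength (R : set E) (s : nat) : Prop :=
  quotient_length base_integers R integers s.

Definition conductor_exponent (pi : F) (R : set E) (f : nat) : Prop :=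
  [set a | integers a /\ forall x, integers x -> R (a * x)] =
  scale_set (pi ^+ f)%:A integers.

End Extension.

Definition class_formula (s f q : nat) : rat :=
  let Q : rat := q%:R in
  match odd s, odd f with
  | false, false =>
      (Q ^+ (s./2 + 2) + 7 * Q ^+ (s./2 + 1) + 4 * Q ^+ s./2
       + (2 * s%:R - 2) * Q ^+ f./2 * (1 - Q) - 8 * Q ^+ (f./2 + 1)
       - 3 * Q ^ (s%:Z - f%:Z + 1) - Q ^ (s%:Z - f%:Z))
      / (Q ^+ f./2 * (Q - 1) ^+ 2)
  | false, true =>
      (4 * Q ^+ (s./2 + 1) + 7 * Q ^+ s./2 + Q ^ (s./2%:Z - 1)
       + (2 * s%:R - 2) * Q ^+ f.-1./2 * (1 - Q) - 8 * Q ^+ (f + 1)./2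
       - Q ^ (s%:Z - f%:Z + 1) - 3 * Q ^ (s%:Z - f%:Z))
      / (Q ^+ f.-1./2 * (Q - 1) ^+ 2)
  | true, false =>
      (4 * Q ^+ (s + 3)./2 + 7 * Q ^+ (s + 1)./2 + Q ^+ s.-1./2
       + (2 * s%:R - 2) * Q ^+ f./2 * (1 - Q) - 8 * Q ^+ (f./2 + 1)
       - 3 * Q ^ (s%:Z - f%:Z + 1) - Q ^ (s%:Z - f%:Z))
      / (Q ^+ f./2 * (Q - 1) ^+ 2)
  | true, true =>
      (Q ^+ (s + 3)./2 + 7 * Q ^+ (s + 1)./2 + 4 * Q ^+ s.-1./2
       + (2 * s%:R - 2) * Q ^+ f.-1./2 * (1 - Q) - 8 * Q ^+ (f + 1)./2
       - Q ^ (s%:Z - f%:Z + 1) - 3 * Q ^ (s%:Z - f%:Z))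
      / (Q ^+ f.-1./2 * (Q - 1) ^+ 2)
  end.

(* Main.v *)
(* Write o = A and O_E = B, with p the common uniformizer. Call y in B primitive
   if it does not lie in A + p B; its class then generates the residue field,
   so that B = A + A y + A y^2. Every fractional ideal can be scaled to satisfy
   1 \in I and I \subset B, and then has the form A + A p^i y + p^j B with
   i <= j and y primitive. In particular R = A + A p^a x + p^b B, where
   b = f, a + b = s and a <= b <= 2 a.
   If j <= 2 i the ideal is itself an overorder of R. If j > 2 i its multiplier
   ring is the overorder S = A + A p^(j - i) y + p^j B, and the ideal is up to
   scaling the dual of S, so its class depends on S only. Hence the classes
   correspond to the overorders S = A + A p^i y + p^j B of R, each counted twice,
   except those with j = 2 i, which are self-dual (Gorenstein) and count once.
   For given i <= j <= 2 i, such an S is a line y of B / A modulo p^(j - i),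
   restricted to those with p^a x \in S; counting the lines gives the sum that
   is evaluated in closed form. *)

Require Import Defs.
From HB Require Import structures.
From mathcomp Require Import all_boot all_order all_algebra all_field.
From mathcomp Require Import all_classical.
From mathcomp Require Import ring zify.

Set Implicit Arguments.
Unset Strict Implicit.
Unset Printing Implicit Defensive.

Import Order.TTheory GRing.Theory Num.Theory.
Local Open Scope classical_set_scope.
Local Open Scope card_scope.
Local Open Scope ring_scope.

(** * Lattices in a cubic unramified pair *)

(* The shape of all modules rests on the residue degree being the prime 3: with no field strictly
   between, every element outside the residue field of [A] generates. Residue fields are never
   formed: degree at most 3 is stated as a relation among any four elements, degree above 2 as
   [B_not_rank2], and an element quadratic modulo [p] is excluded because it would make the degree
   2. The lower bound has to come from [R]: [B] is only given as an integral closure, while [R] is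
   finitely generated over [A] and contains [p^f B]. Once 1, y, y^2 is a basis, statements about
   lattices become divisibility of two coordinates. Counting through overorders works because
   multiplier rings are unchanged by scaling; the two classes over one ring differ because the dual
   is not principal when j < 2 i. The dual is formed with a functional that depends on y, whereas
   the ring fixes y only modulo a power of p, so independence of y needs an argument of its own.
   Lines of B / A, which has rank 2, need two charts: nonvertical and vertical slopes. *)
Create HintDb closure.

(* [A] and [B] stand for the integers of [F] and [E], both viewed inside [E], and
   [p] for their common uniformizer. *)
Record cubic_pair (E : fieldType) (A B : set E) (p : E) : Prop := CubicPair {
  subringA : subring A;
  subringB : subring B;
  subAB : A `<=` B;
  A_p : A p;
  BVp : ~ B p^-1;
  A_split : forall c, A c -> c != 0 ->
    exists n u, [/\ A u, A u^-1, u != 0 & c = p ^+ n * u];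
  B_split : forall z, B z -> z != 0 ->
    exists n u, [/\ B u, B u^-1, u != 0 & z = p ^+ n * u];
  B_denominator : forall z, exists n, B (p ^+ n * z);
  A_dependent : forall w0 w1 w2 w3 : E, exists c0 c1 c2 c3,
    [/\ [/\ A c0, A c1, A c2 & A c3],
       c0 * w0 + c1 * w1 + c2 * w2 + c3 * w3 = 0
     & ~ [/\ scale_set p A c0, scale_set p A c1,
             scale_set p A c2 & scale_set p A c3]];
  B_not_rank2 : forall x, B x -> exists2 w, B w & forall c d w',
    A c -> A d -> B w' -> w <> c + d * x + p * w'
}.

Lemma least_nat (P : nat -> Prop) : (exists n, P n) ->
  exists2 n, P n & forall m, P m -> (n <= m)%N.
Proof.
move=> [n Pn]; have exP : exists n, `[< P n >] by exists n; apply/asboolP.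
case: (ex_minnP exP) => m /asboolP Pm mP.
by exists m => // k Pk; apply/mP/asboolP.
Qed.

Section CubicPair.
Variables (E : fieldType) (A B : set E) (p : E).
Hypothesis AB : cubic_pair A B p.

Local Notation pA n := (scale_set (p ^+ n) A).
Local Notation pB n := (scale_set (p ^+ n) B).

(** * Divisibility by powers of [p] in [A] and in [B] *)

Lemma A1 : A 1. Proof. by case: (subringA AB). Qed.
Lemma A_sub x y : A x -> A y -> A (x - y).
Proof. by case: (subringA AB) => _ + _; apply. Qed.
Lemma A_mul x y : A x -> A y -> A (x * y).
Proof. by case: (subringA AB) => _ _; apply. Qed.
Lemma A0 : A 0. Proof. by rewrite -(subrr 1); apply: A_sub; apply: A1. Qed.
Lemma A_opp x : A x -> A (- x).
Proof. by move=> Ax; rewrite -sub0r; apply: A_sub Ax; apply: A0. Qed.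
Lemma A_add x y : A x -> A y -> A (x + y).
Proof. by move=> Ax /A_opp Ay; rewrite -[y]opprK; apply: A_sub. Qed.
Lemma A_exp x n : A x -> A (x ^+ n).
Proof.
by move=> Ax; elim: n => [|n IH]; [exact: A1|rewrite exprS; apply: A_mul].
Qed.
Lemma A_pX n : A (p ^+ n). Proof. exact: A_exp (A_p AB). Qed.

Lemma B1 : B 1. Proof. by case: (subringB AB). Qed.
Lemma B_sub x y : B x -> B y -> B (x - y).
Proof. by case: (subringB AB) => _ + _; apply. Qed.
Lemma B_mul x y : B x -> B y -> B (x * y).
Proof. by case: (subringB AB) => _ _; apply. Qed.
Lemma B0 : B 0. Proof. by rewrite -(subrr 1); apply: B_sub; apply: B1. Qed.
Lemma B_opp x : B x -> B (- x).
Proof. by move=> Bx; rewrite -sub0r; apply: B_sub Bx; apply: B0. Qed.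
Lemma B_add x y : B x -> B y -> B (x + y).
Proof. by move=> Bx /B_opp By; rewrite -[y]opprK; apply: B_sub. Qed.
Lemma B_exp x n : B x -> B (x ^+ n).
Proof.
by move=> Bx; elim: n => [|n IH]; [exact: B1|rewrite exprS; apply: B_mul].
Qed.
Lemma B_A x : A x -> B x. Proof. exact: (subAB AB). Qed.

#[local] Hint Resolve A0 A1 A_opp A_add A_mul A_exp A_pX B0 B1 B_opp B_add B_mul
  B_exp B_A : closure.
Local Ltac cl := auto 20 with closure.

Lemma p_neq0 : p != 0.
Proof. by apply/eqP => p0; apply: (BVp AB); rewrite p0 invr0; cl. Qed.

Lemma pX_neq0 n : p ^+ n != 0. Proof. by rewrite expf_neq0 ?p_neq0. Qed.
#[local] Hint Resolve pX_neq0 : core.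

Lemma pX_split m n : (m <= n)%N -> p ^+ n = p ^+ m * p ^+ (n - m).
Proof. by move=> ?; rewrite -exprD subnKC. Qed.

Lemma pX_Bunit n u z : (0 < n)%N -> B u^-1 -> u != 0 -> B z ->
  u <> p ^+ n * z.
Proof.
case: n => // n _ Bu u0 Bz uE; apply: (BVp AB).
have -> : p^-1 = u^-1 * p ^+ n * z; last by cl.
have z0 : z != 0 by apply: contraNneq u0 => z0; rewrite uE z0 mulr0.
by rewrite uE exprS; field; rewrite p_neq0 z0 pX_neq0.
Qed.

(** Valuations in [A] and [B] agree: if c = p^m u with u a unit of [A] and m < n, then u would be
    divisible by p in [B]. *)
Lemma pA_pB n c : A c -> pB n c -> pA n c.
Proof.
move=> Ac [z Bz zE]; have [->|c0] := eqVneq c 0; first by exists 0; cl; rewrite mulr0.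
have [m [u [Au AVu u0 cE]]] := A_split AB Ac c0.
have [le_nm|lt_mn] := leqP n m.
  by exists (p ^+ (m - n) * u); cl; rewrite mulrA -pX_split.
case: (@pX_Bunit (n - m)%N u z); rewrite ?subn_gt0 //; first by cl.
apply: (mulfI (pX_neq0 m)); rewrite mulrA -pX_split ?zE //; exact: ltnW.
Qed.

Lemma A_unitVpA c : A c -> (c != 0 /\ A c^-1) \/ pA 1 c.
Proof.
move=> Ac; have [->|c0] := eqVneq c 0; first by right; exists 0; cl; rewrite mulr0.
have [[|m] [u [Au AVu u0 cE]]] := A_split AB Ac c0.
  by left; split; rewrite // cE expr0 mul1r.
by right; exists (p ^+ m * u); cl; rewrite expr1 cE exprS mulrA.
Qed.

Lemma B_unitVpB c : B c -> (c != 0 /\ B c^-1) \/ pB 1 c.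
Proof.
move=> Ac; have [->|c0] := eqVneq c 0; first by right; exists 0; cl; rewrite mulr0.
have [[|m] [u [Au AVu u0 cE]]] := B_split AB Ac c0.
  by left; split; rewrite // cE expr0 mul1r.
by right; exists (p ^+ m * u); cl; rewrite expr1 cE exprS mulrA.
Qed.

Lemma pB_prime y z : B y -> B z -> pB 1 (y * z) -> pB 1 y \/ pB 1 z.
Proof.
move=> By Bz [w Bw wE]; have [[y0 BVy]|] := B_unitVpB By; last by left.
right; exists (w * y^-1); first by cl.
by rewrite mulrA wE; field.
Qed.

Lemma pA_add n x y : pA n x -> pA n y -> pA n (x + y).
Proof. by move=> [c ? <-] [d ? <-]; exists (c + d); cl; rewrite mulrDr. Qed.
Lemma pA_mull n a x : A a -> pA n x -> pA n (a * x).
Proof. by move=> ? [c ? <-]; exists (a * c); cl; ring. Qed.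
Lemma pA_opp n x : pA n x -> pA n (- x).
Proof. by move=> [c ? <-]; exists (- c); cl; ring. Qed.
Lemma pB_add n x y : pB n x -> pB n y -> pB n (x + y).
Proof. by move=> [c ? <-] [d ? <-]; exists (c + d); cl; rewrite mulrDr. Qed.
Lemma pB_mull n a x : B a -> pB n x -> pB n (a * x).
Proof. by move=> ? [c ? <-]; exists (a * c); cl; ring. Qed.
Lemma pB_opp n x : pB n x -> pB n (- x).
Proof. by move=> [c ? <-]; exists (- c); cl; ring. Qed.
Lemma pB_pA n x : pA n x -> pB n x.
Proof. by move=> [c ? <-]; exists c; cl. Qed.
Lemma pA_le m n x : (m <= n)%N -> pA n x -> pA m x.
Proof.
by move=> le_mn [c ? <-]; exists (p ^+ (n - m) * c); cl; rewrite mulrA -pX_split.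
Qed.
Lemma pB_le m n x : (m <= n)%N -> pB n x -> pB m x.
Proof.
by move=> le_mn [c ? <-]; exists (p ^+ (n - m) * c); cl; rewrite mulrA -pX_split.
Qed.
Lemma pA_shift m n x : pA (m + n) (p ^+ m * x) -> pA n x.
Proof.
by move=> [c Ac /eqP]; rewrite exprD -mulrA => /eqP /(mulfI (pX_neq0 m)) <-; exists c.
Qed.
Lemma pB_shift m n x : pB (m + n) (p ^+ m * x) -> pB n x.
Proof.
by move=> [c Ac /eqP]; rewrite exprD -mulrA => /eqP /(mulfI (pX_neq0 m)) <-; exists c.
Qed.

(** * Primitive elements and the basis 1, y, y^2 of [B] *)

Definition primitive x := B x /\ forall c w, A c -> B w -> x <> c + p * w.

Lemma primitive_ex : exists x, primitive x.
Proof.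
have [w Bw wP] := B_not_rank2 AB B1; exists w; split => // c w' Ac Bw' wE.
by apply: (wP c 0 w'); cl; rewrite mul0r addr0.
Qed.

Lemma linear_pB x c d : primitive x -> A c -> A d -> pB 1 (c + d * x) ->
  pA 1 c /\ pA 1 d.
Proof.
move=> [Bx xP] Ac Ad [w Bw wE].
have pd : pA 1 d.
  case: (A_unitVpA Ad) => // -[d0 AVd]; case: (xP (- d^-1 * c) (d^-1 * w)); cl.
  apply: (mulfI d0); rewrite mulrDr; apply/(addrI c); rewrite -wE expr1; field.
  exact: d0.
split=> //; apply: pA_pB => //.
have -> : c = p ^+ 1 * w - x * d by rewrite wE; ring.
apply: pB_add; first by exists w.
by apply/pB_opp/pB_mull => //; apply: pB_pA.
Qed.

(** A relation among 1, x, w, x w reads (c2 + c3 x) w = - (c0 + c1 x). Since x is quadratic modulo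
    p, c2 + c3 x can be inverted modulo p through its norm, so 1 and x already span the residue
    field. *)
Lemma span_mod_quadratic x a b w : primitive x -> A a -> A b -> B w ->
  pB 1 (x ^+ 2 - (a * x + b)) ->
  exists c d w', [/\ A c, A d, B w' & w = c + d * x + p * w'].
Proof.
move=> xP Aa Ab Bw [r Br rE]; have Bx : B x by case: xP.
have [c0 [c1 [c2 [c3 [[A0 A1 A2 A3] dep prim]]]]] := A_dependent AB 1 x w (x * w).
(* Norm and conjugate of c2 + c3 x, the conjugate of x being a - x modulo p. *)
pose N := c2 ^+ 2 + c2 * c3 * a - c3 ^+ 2 * b.
pose C := c2 + c3 * a - c3 * x.
have NE : (c2 + c3 * x) * C = N - c3 ^+ 2 * (p * r).
  by rewrite /C /N -[p * r]/(p ^+ 1 * r) rE; ring.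
have AN : A N by rewrite /N; cl.
case: (A_unitVpA AN) => [[N0 AVN]|pN].
  have wE : N * w = (- (c0 * (c2 + c3 * a)) + c1 * c3 * b) +
      (c0 * c3 - c1 * c2) * x + p * (c3 ^+ 2 * r * w + c1 * c3 * r).
    have -> : N * w = (c2 + c3 * x) * w * C + c3 ^+ 2 * (p * r) * w.
      by rewrite mulrAC NE; ring.
    have -> : (c2 + c3 * x) * w = - (c0 + c1 * x).
      by apply/eqP; rewrite -subr_eq0 -[X in _ == X]dep; apply/eqP; ring.
    have xx : x ^+ 2 = p * r + (a * x + b) by rewrite -[p * r]/(p ^+ 1 * r) rE; ring.
    rewrite /C; transitivity (- (c0 * (c2 + c3 * a)) + (c0 * c3 - c1 * c2 - c1 * c3 * a) * x
       + c1 * c3 * x ^+ 2 + p * (c3 ^+ 2 * r * w)); first by ring.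
    by rewrite xx; ring.
  exists (N^-1 * (- (c0 * (c2 + c3 * a)) + c1 * c3 * b)),
     (N^-1 * (c0 * c3 - c1 * c2)), (N^-1 * (c3 ^+ 2 * r * w + c1 * c3 * r)).
  split; cl.
  by apply: (mulfI N0); rewrite wE; field.
(* If the norm vanishes modulo p, so does one of the two factors; then all four coefficients lie in
   p A, against the choice of the relation. *)
have pNE : pB 1 ((c2 + c3 * x) * C).
  rewrite NE; apply: pB_add; first exact: pB_pA.
  by apply: pB_opp; exists (c3 ^+ 2 * r); cl; ring.
have [pc2 pc3] : pA 1 c2 /\ pA 1 c3.
  have BC : B C by rewrite /C; cl.
  have Bl : B (c2 + c3 * x) by cl.
  case: (pB_prime Bl BC pNE); first exact: linear_pB.
  rewrite /C -mulNr => /(linear_pB xP) [||pc pd]; cl.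
  have pc3 : pA 1 c3 by rewrite -[c3]opprK; apply: pA_opp.
  split => //; have -> : c2 = (c2 + c3 * a) - a * c3 by ring.
  by apply: pA_add => //; apply/pA_opp/pA_mull.
have /(linear_pB xP) [||pc0 pc1] // : pB 1 (c0 + c1 * x).
  have -> : c0 + c1 * x = - (w * c2 + (x * w) * c3).
    by apply/eqP; rewrite -subr_eq0 -[X in _ == X]dep; apply/eqP; ring.
  by apply/pB_opp/pB_add; apply: pB_mull; cl; apply: pB_pA.
by case: prim; rewrite -[p]expr1.
Qed.

(** Were c2 a unit, x would be quadratic modulo p and B = A + A x + p B, against [B_not_rank2]. *)
Lemma quadratic_pB1 x c0 c1 c2 : primitive x -> A c0 -> A c1 -> A c2 ->
  pB 1 (c0 + c1 * x + c2 * x ^+ 2) -> [/\ pA 1 c0, pA 1 c1 & pA 1 c2].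
Proof.
move=> xP Ac0 Ac1 Ac2 pc; have Bx : B x by case: xP.
case: (A_unitVpA Ac2) => [[c20 AVc2]|pc2].
  have [w Bw wP] := B_not_rank2 AB Bx.
  case: (@span_mod_quadratic x (- c2^-1 * c1) (- c2^-1 * c0) w) => //; cl.
    have -> : x ^+ 2 - (- c2^-1 * c1 * x + - c2^-1 * c0) =
      c2^-1 * (c0 + c1 * x + c2 * x ^+ 2) by field.
    by apply: pB_mull; cl.
  by move=> c [d [w' [Ac Ad Bw' wE]]]; case: (wP c d w').
have [|? ?] := @linear_pB x c0 c1 xP Ac0 Ac1; last by [].
have -> : c0 + c1 * x = (c0 + c1 * x + c2 * x ^+ 2) - (x ^+ 2 * c2) by ring.
by apply: pB_add => //; apply/pB_opp/pB_mull; cl; apply: pB_pA.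
Qed.

Lemma quadratic_pB x n c0 c1 c2 : primitive x -> A c0 -> A c1 -> A c2 ->
  pB n (c0 + c1 * x + c2 * x ^+ 2) -> [/\ pA n c0, pA n c1 & pA n c2].
Proof.
move=> xP; elim: n c0 c1 c2 => [|n IH] c0 c1 c2 Ac0 Ac1 Ac2 pc.
  by split; [exists c0|exists c1|exists c2]; rewrite // expr0 mul1r.
have [[d0 Ad0 E0] [d1 Ad1 E1] [d2 Ad2 E2]] :=
  quadratic_pB1 xP Ac0 Ac1 Ac2 (pB_le (ltn0Sn n) pc).
have [|e0 e1 e2] := IH d0 d1 d2 Ad0 Ad1 Ad2.
  apply: (@pB_shift 1); rewrite add1n.
  have -> : p ^+ 1 * (d0 + d1 * x + d2 * x ^+ 2) =
    p ^+ 1 * d0 + p ^+ 1 * d1 * x + p ^+ 1 * d2 * x ^+ 2 by ring.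
  by rewrite E0 E1 E2.
have S d : pA n d -> pA n.+1 (p ^+ 1 * d).
  by move=> [e ? <-]; exists e; rewrite // exprS expr1 mulrA.
by split; rewrite -?E0 -?E1 -?E2; apply: S.
Qed.

Lemma pA_zero c : A c -> (forall n, pA n c) -> c = 0.
Proof.
move=> Ac cP; apply/eqP; apply/negPn/negP => c0.
have [n [u [Au AVu u0 cE]]] := A_split AB Ac c0.
have [d Ad dE] := cP n.+1.
apply: (@pX_Bunit 1 u d); cl; apply: (mulfI (pX_neq0 n)).
by rewrite -cE -dE exprSr mulrA.
Qed.

Lemma quadratic_eq x c0 c1 c2 d0 d1 d2 : primitive x ->
  A c0 -> A c1 -> A c2 -> A d0 -> A d1 -> A d2 ->
  c0 + c1 * x + c2 * x ^+ 2 = d0 + d1 * x + d2 * x ^+ 2 ->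
  [/\ c0 = d0, c1 = d1 & c2 = d2].
Proof.
move=> xP Ac0 Ac1 Ac2 Ad0 Ad1 Ad2 cd.
have H n : [/\ pA n (c0 - d0), pA n (c1 - d1) & pA n (c2 - d2)].
  apply: (quadratic_pB xP); cl; exists 0; cl; rewrite mulr0.
  transitivity ((c0 + c1 * x + c2 * x ^+ 2) - (d0 + d1 * x + d2 * x ^+ 2)); last ring.
  by rewrite cd subrr.
have H0 : c0 - d0 = 0 by apply: pA_zero; [cl|move=> n; case: (H n)].
have H1 : c1 - d1 = 0 by apply: pA_zero; [cl|move=> n; case: (H n)].
have H2 : c2 - d2 = 0 by apply: pA_zero; [cl|move=> n; case: (H n)].
by split; apply/eqP; rewrite -subr_eq0; apply/eqP.
Qed.

(** In a relation among 1, x, x^2, z with some coefficient outside p A, the coefficient of z is a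
    unit: otherwise independence modulo p would put the other three in p A as well. *)
Lemma quadratic_ex x z : primitive x -> B z -> exists c0 c1 c2,
  [/\ A c0, A c1, A c2 & z = c0 + c1 * x + c2 * x ^+ 2].
Proof.
move=> xP Bz.
have [c0 [c1 [c2 [d [[Ac0 Ac1 Ac2 Ad] dep prim]]]]] := A_dependent AB 1 x (x ^+ 2) z.
case: (A_unitVpA Ad) => [[d0 AVd]|pd].
  exists (- d^-1 * c0), (- d^-1 * c1), (- d^-1 * c2); split; cl.
  apply: (mulfI d0); apply: (addrI (c0 * 1 + c1 * x + c2 * x ^+ 2)); rewrite dep.
  by field.
case: prim; have [|? ? ?] := quadratic_pB1 xP Ac0 Ac1 Ac2; last by rewrite -[p]expr1.
have -> : c0 + c1 * x + c2 * x ^+ 2 = - (z * d).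
  by apply/eqP; rewrite -subr_eq0 -[X in _ == X]dep; apply/eqP; ring.
by apply/pB_opp/pB_mull; cl; apply: pB_pA.
Qed.

Lemma pA_pX m n : pA m (p ^+ n) -> (m <= n)%N.
Proof.
move=> [c Ac cE]; rewrite leqNgt; apply/negP => lt_nm.
apply: (@pX_Bunit (m - n)%N 1 c); rewrite ?subn_gt0 ?invr1 ?oner_neq0 //; cl.
by apply: (mulfI (pX_neq0 n)); rewrite mulrA -pX_split ?mulr1 // ltnW.
Qed.

Lemma not_pA_unit m c : c != 0 -> A c^-1 -> pA m c -> m = 0%N.
Proof.
move=> c0 AVc pc; apply/eqP; rewrite -leqn0; apply: pA_pX.
by have := pA_mull AVc pc; rewrite mulVf.
Qed.

Lemma primitive_quadratic x c d e : primitive x -> A c -> A d -> A e ->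
  primitive (c + d * x + e * x ^+ 2) <-> ~ (pA 1 d /\ pA 1 e).
Proof.
move=> xP Ac Ad Ae; have Bx : B x by case: xP.
split=> [[_ yP] [[d' ? dE] [e' ? eE]]|de].
  by apply: (yP c (d' * x + e' * x ^+ 2)); cl; rewrite -dE -eE; ring.
split=> [|c' w Ac' Bw yE]; first by cl.
have [||||_ pd pe] := @quadratic_pB x 1 (c - c') d e xP; cl.
exists w; rewrite // expr1; apply/(addrI c'); rewrite -yE; ring.
Qed.

(** * The lattices A + A p^i y + p^j B *)

Definition lattice i j y : set E := [set z | exists c d w,
  [/\ A c, A d, B w & z = c + d * (p ^+ i * y) + p ^+ j * w]].

(** The summand p^j B adds nothing to the coefficient of y because i <= j, so the lattice has the
    basis 1, p^i y, p^j y^2. *)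
Lemma lattice_quadratic i j y c d e : primitive y -> A c -> A d -> A e ->
  (i <= j)%N ->
  lattice i j y (c + d * y + e * y ^+ 2) <-> pA i d /\ pA j e.
Proof.
move=> yP Ac Ad Ae le_ij; have By : B y by case: yP.
split=> [[c' [d' [w [Ac' Ad' Bw zE]]]]|[[d' Ad' <-] [e' Ae' <-]]]; last first.
  by exists c, d', (e' * y ^+ 2); split; cl; ring.
have [w0 [w1 [w2 [Aw0 Aw1 Aw2 wE]]]] := quadratic_ex yP Bw.
have [|||||||_ -> ->] := @quadratic_eq y c d e (c' + p ^+ j * w0)
  (p ^+ i * d' + p ^+ j * w1) (p ^+ j * w2) yP; cl.
  by rewrite zE wE; ring.
split; last by exists w2.
by apply: pA_add; [exists d'|apply: (pA_le le_ij); exists w1].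
Qed.

Lemma submodule_sub M x y : submodule A M -> M x -> M y -> M (x - y).
Proof.
move=> [_ MD MZ] Mx My; apply: MD => //; rewrite -mulN1r; apply: MZ => //; cl.
Qed.

Lemma lattice_submodule i j y : submodule A (lattice i j y).
Proof.
split.
- by exists 0, 0, 0; split; cl; ring.
- move=> _ _ [c [d [w [Ac Ad Bw ->]]]] [c' [d' [w' [Ac' Ad' Bw' ->]]]].
  by exists (c + c'), (d + d'), (w + w'); split; cl; ring.
- move=> a _ Aa [c [d [w [Ac Ad Bw ->]]]].
  by exists (a * c), (a * d), (a * w); split; cl; ring.
Qed.

Lemma lattice_A i j y : A `<=` lattice i j y.
Proof. by move=> c Ac; exists c, 0, 0; split; cl; ring. Qed.

Lemma lattice_gen i j y : lattice i j y (p ^+ i * y).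
Proof. by exists 0, 1, 0; split; cl; ring. Qed.

Lemma lattice_pB i j y : pB j `<=` lattice i j y.
Proof. by move=> _ [w Bw <-]; exists 0, 0, w; split; cl; ring. Qed.

Lemma lattice_B i j y : B y -> lattice i j y `<=` B.
Proof. by move=> By _ [c [d [w [Ac Ad Bw ->]]]]; cl. Qed.

Lemma lattice_conductor i j n y : primitive y -> (i <= j)%N ->
  pB n `<=` lattice i j y -> (j <= n)%N.
Proof.
move=> yP le_ij nP; have By : B y by case: yP.
have : lattice i j y (0 + 0 * y + p ^+ n * y ^+ 2).
  by apply: nP; exists (y ^+ 2); cl; ring.
by case/lattice_quadratic => // ; cl => _ /pA_pX.
Qed.

Lemma lattice_exponent i j n y : primitive y ->
  (forall z, lattice i j y z -> exists c w, [/\ A c, B w & z = c + p ^+ n * w]) ->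
  (n <= i)%N.
Proof.
move=> yP nP; have [c [w [Ac Bw zE]]] := nP _ (lattice_gen i j y).
have [||||_ /pA_pX //] := @quadratic_pB y n (- c) (p ^+ i) 0 yP; cl.
by exists w; rewrite // mul0r addr0 zE; ring.
Qed.

Lemma lattice_decompose i j y z : (i <= j)%N -> B y -> lattice i j y z ->
  exists c w, [/\ A c, B w & z = c + p ^+ i * w].
Proof.
move=> le_ij By [c [d [w [Ac Ad Bw ->]]]]; exists c, (d * y + p ^+ (j - i) * w).
by split; cl; rewrite (pX_split le_ij); ring.
Qed.

(** Both exponents are intrinsic: j is the least n with p^n B inside the lattice, i the greatest n
    with the lattice inside A + p^n B. *)
Lemma lattice_inj i j i' j' y y' : primitive y -> primitive y' ->
  (i <= j)%N -> (i' <= j')%N -> lattice i j y = lattice i' j' y' ->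
  i = i' /\ j = j'.
Proof.
move=> yP y'P ij ij' eqL; have [By _] := yP; have [By' _] := y'P.
have jj : j = j'.
  apply/eqP; rewrite eqn_leq; apply/andP; split.
    by apply: (lattice_conductor yP ij); rewrite eqL; apply: lattice_pB.
  by apply: (lattice_conductor y'P ij'); rewrite -eqL; apply: lattice_pB.
split=> //; apply/eqP; rewrite eqn_leq; apply/andP; split.
  by apply: (@lattice_exponent i' j' i y') => // z; rewrite -eqL; apply: lattice_decompose.
by apply: (@lattice_exponent i j i' y) => // z; rewrite eqL; apply: lattice_decompose.
Qed.

(** Only the line of y in B / A modulo p^(j - i) matters: e0 is absorbed by A, the unit e1 by the
    coefficient of p^i y, and p^i p^(j - i) w by p^j B. *)
Lemma lattice_change i j y y' e0 e1 w : (i <= j)%N -> A e0 -> A e1 ->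
  A e1^-1 -> e1 != 0 -> B w -> y' = e0 + e1 * y + p ^+ (j - i) * w ->
  lattice i j y' = lattice i j y.
Proof.
move=> le_ij.
have sub f0 f1 u z z' : A f0 -> A f1 -> B u ->
    z' = f0 + f1 * z + p ^+ (j - i) * u -> lattice i j z' `<=` lattice i j z.
  move=> Af0 Af1 Bu z'E _ [c [d [v [Ac Ad Bv ->]]]].
  exists (c + p ^+ i * d * f0), (d * f1), (d * u + v); split; cl.
  by rewrite z'E (pX_split le_ij); ring.
move=> Ae0 Ae1 AVe1 e10 Bw y'E; apply/seteqP; split; first exact: sub y'E.
apply: (sub (- e1^-1 * e0) e1^-1 (- e1^-1 * w)); cl.
by rewrite y'E; field.
Qed.

Lemma lattice_subring i j y : B y -> (i <= j <= 2 * i)%N ->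
  subring (lattice i j y).
Proof.
move=> By /andP[ij ji]; have [L0 LD LZ] := lattice_submodule i j y; split.
- by apply: lattice_A; cl.
- by move=> z z'; apply: submodule_sub.
- move=> _ _ [c [d [w [Ac Ad Bw ->]]]] [c' [d' [w' [Ac' Ad' Bw' ->]]]].
  exists (c * c'), (c * d' + c' * d), (p ^+ (2 * i - j) * (d * d' * y ^+ 2) +
     w * (c' + d' * (p ^+ i * y) + p ^+ j * w') + w' * (c + d * (p ^+ i * y))).
  split; cl.
  have E2 : p ^+ i * p ^+ i = p ^+ j * p ^+ (2 * i - j).
    by rewrite -pX_split // -exprD addnn mul2n.
  transitivity (c * c' + (c * d' + c' * d) * (p ^+ i * y)
    + (p ^+ i * p ^+ i) * (d * d' * y ^+ 2) +
     p ^+ j * (w * (c' + d' * (p ^+ i * y) + p ^+ j * w') + w' * (c + d * (p ^+ i * y)))).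
    ring.
  by rewrite E2; ring.
Qed.

(* The exponents are the least [j] with [p^j B] inside [M] and the least [i]
   such that [p^i y] lies in [M] for some primitive [y]. *)
Lemma lattice_ex M n : submodule A M -> M 1 -> M `<=` B -> pB n `<=` M ->
  exists i j y, [/\ primitive y, (i <= j)%N & M = lattice i j y].
Proof.
move=> Msub M1 MB nM; have [M0 MD MZ] := Msub.
have MA c : A c -> M c by move=> Ac; rewrite -[c]mulr1; apply: MZ.
have [j jM jmin] := @least_nat (fun n => pB n `<=` M) (ex_intro _ n nM).
have [y0 y0P] := primitive_ex.
have [|i [y yP yM] imin] := @least_nat (fun n => exists2 y, primitive y & M (p ^+ n * y)).
  by exists j, y0 => //; apply: jM; exists y0 => //; case: y0P.
have le_ij : (i <= j)%N.
  by apply: imin; exists y0 => //; apply: jM; exists y0 => //; case: y0P.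
exists i, j, y; split=> //; have By : B y by case: yP.
apply/seteqP; split=> [z Mz|_ [c [d [w [Ac Ad Bw ->]]]]]; last first.
  by apply: (MD); [apply: (MD); [exact: MA|exact: MZ]|apply: jM; exists w].
have [c0 [c1 [c2 [Ac0 Ac1 Ac2 zE]]]] := quadratic_ex yP (MB _ Mz).
(* Minimality of i: once p^l divides c1 and c2, either p divides both cofactors, or they are the
   coefficients of a primitive y' with p^l y' in M. *)
have H l : (l <= i)%N -> pA l c1 /\ pA l c2.
  elim: l => [_|l IH lti].
    by split; [exists c1|exists c2]; rewrite // expr0 mul1r.
  have [[d1 Ad1 d1E] [d2 Ad2 d2E]] := IH (ltnW lti).
  have [[pd1 pd2]|/(primitive_quadratic yP A0 Ad1 Ad2) y'P] :=
      pselect (pA 1 d1 /\ pA 1 d2).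
    have S d : pA 1 d -> pA l.+1 (p ^+ l * d).
      by move=> [d' ? <-]; exists d'; rewrite // exprSr expr1 mulrA.
    by split; rewrite -?d1E -?d2E; apply: S.
  have : (i <= l)%N; last by rewrite leqNgt lti.
  apply: imin; exists (0 + d1 * y + d2 * y ^+ 2) => //.
  have -> : p ^+ l * (0 + d1 * y + d2 * y ^+ 2) = z - c0.
    by rewrite zE -d1E -d2E; ring.
  by apply: submodule_sub => //; apply: MA.
have [pc1 pc2] := H i (leqnn i).
have Mc2 : M (c2 * y ^+ 2).
  have [d1 Ad1 d1E] := pc1.
  have -> : c2 * y ^+ 2 = z - c0 - d1 * (p ^+ i * y) by rewrite zE -d1E; ring.
  apply: (submodule_sub Msub); last exact: MZ.
  by apply: (submodule_sub Msub) => //; apply: MA.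
rewrite zE; apply/lattice_quadratic => //; split=> //.
(* Minimality of j: if c2 is a unit times p^(i + l), then M contains the products of p^(i + l) with
   1, y and y^2, hence p^(i + l) B. *)
have H2 l : (i + l <= j)%N -> pA (i + l) c2.
  elim: l => [|l IH ltj]; first by rewrite addn0.
  have [|d Ad dE] := IH; first by rewrite ltnW // -addnS.
  case: (A_unitVpA Ad) => [[d0 AVd]|[d' Ad' d'E]]; last first.
    by exists d'; rewrite // addnS exprSr -mulrA -dE -d'E expr1.
  have : (j <= i + l)%N; last by rewrite leqNgt -addnS ltj.
  apply: jmin => _ [w Bw <-].
  have [w0 [w1 [w2 [Aw0 Aw1 Aw2 ->]]]] := quadratic_ex yP Bw.
  have -> : p ^+ (i + l) * (w0 + w1 * y + w2 * y ^+ 2) = p ^+ (i + l) * w0 +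
     (p ^+ l * w1) * (p ^+ i * y) + (w2 * d^-1) * (c2 * y ^+ 2).
    by rewrite -dE exprD; field.
  by apply: (MD); [apply: (MD)|]; [apply: MA|apply: MZ|apply: MZ]; cl.
by rewrite -(subnKC le_ij); apply: H2; rewrite subnKC.
Qed.

(** * Multiplier rings and duality *)

Definition multiplier (M : set E) : set E := [set t | forall z, M z -> M (t * z)].

Lemma multiplier_subring S : subring S -> multiplier S = S.
Proof.
move=> [S1 _ SM]; apply/seteqP; split=> [t /(_ 1 S1)|t St z Sz]; last exact: SM.
by rewrite mulr1.
Qed.

Lemma multiplier_scale a M : a != 0 -> multiplier (scale_set a M) = multiplier M.
Proof.
move=> a0; apply/seteqP; split=> t tM.
  move=> z Mz; have [z' Mz' /eqP] := tM (a * z) (imageP _ Mz).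
  by rewrite mulrCA => /eqP/(mulfI a0) <-.
by move=> _ [z Mz <-]; exists (t * z); [exact: tM|rewrite mulrCA].
Qed.

(** A multiplier t maps 1 into the lattice, so t = c + d p^k y modulo p^j B. The coefficient p^(2 k)
    d of y^2 in t p^k y must be divisible by p^j, which makes d divisible by p^(j - 2 k). *)
Lemma multiplier_lattice k j y : primitive y -> (2 * k <= j)%N ->
  multiplier (lattice k j y) = lattice (j - k) j y.
Proof.
move=> yP kj; have By : B y by case: yP.
have le_kj : (k <= j)%N by lia.
have [L0 LD LZ] := lattice_submodule k j y.
have jE : p ^+ j = p ^+ (j - k) * p ^+ k by rewrite -exprD subnK.
apply/seteqP; split=> [t tL|_ [c [d [w [Ac Ad Bw ->]]]] _ [c' [d' [w' [Ac' Ad' Bw' ->]]]]].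
  have := tL 1 (lattice_A _ _ _ A1); rewrite mulr1 => -[c [d [w [Ac Ad Bw tE]]]].
  have : lattice k j y (0 + 0 * y + (p ^+ (2 * k) * d) * y ^+ 2).
    have -> : 0 + 0 * y + (p ^+ (2 * k) * d) * y ^+ 2 =
       t * (p ^+ k * y) - (c * (p ^+ k * y) + p ^+ j * (w * p ^+ k * y)).
      by rewrite tE mul2n -addnn exprD; ring.
    apply: submodule_sub => //; first by apply: tL; apply: lattice_gen.
    apply: (LD); first by apply: LZ => //; apply: lattice_gen.
    by apply: lattice_pB; exists (w * p ^+ k * y); cl.
  case/lattice_quadratic => //; cl => _; rewrite -{1}(subnKC kj) => /pA_shift [d' Ad' dE].
  exists c, d', w; split=> //; rewrite tE -dE.
  have -> : (j - k = (j - 2 * k) + k)%N by lia.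
  by rewrite exprD; ring.
exists (c * c'), (c * d' + d * c' * p ^+ (j - 2 * k)), (d * d' * y ^+ 2 +
     w * (c' + d' * (p ^+ k * y) + p ^+ j * w') + w' * (c + d * (p ^+ (j - k) * y))).
split; cl.
have E1 : p ^+ (j - k) = p ^+ k * p ^+ (j - 2 * k).
  by rewrite -exprD; congr (_ ^+ _); lia.
have E2 : p ^+ j = p ^+ k * p ^+ k * p ^+ (j - 2 * k).
  by rewrite -!exprD; congr (_ ^+ _); lia.
by rewrite E1 E2; ring.
Qed.

(** Supplies the functional whose pairing lam (u v) defines duals; it is total, with default value 0
    outside [B]. *)
Lemma top_coefficient_ex y : primitive y -> exists lam : E -> E,
  [/\ forall z, B z -> A (lam z),
      forall c d e, A c -> A d -> A e -> lam (c + d * y + e * y ^+ 2) = e,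
      forall z z', B z -> B z' -> lam (z + z') = lam z + lam z'
    & forall a z, A a -> B z -> lam (a * z) = a * lam z].
Proof.
move=> yP; have By : B y by case: yP.
pose P z e := exists c d, [/\ A c, A d, A e & z = c + d * y + e * y ^+ 2].
pose lam z := xget 0 [set e | P z e].
have lamP z : B z -> P z (lam z).
  move=> Bz; apply: (@xgetPex _ 0 [set e | P z e]).
  by have [c [d [e [? ? ? ?]]]] := quadratic_ex yP Bz; exists e, c, d.
have lamE c d e : A c -> A d -> A e -> lam (c + d * y + e * y ^+ 2) = e.
  move=> Ac Ad Ae; have [|c' [d' [Ac' Ad' Ae']]] := lamP (c + d * y + e * y ^+ 2).
    by cl.
  by case/(quadratic_eq yP).
exists lam; split=> // [z /lamP[c [d []]] //|z z'|a z].
  move=> /lamP[c [d [Ac Ad Ae zE]]] /lamP[c' [d' [Ac' Ad' Ae' zE']]].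
  rewrite -[RHS](lamE (c + c') (d + d')); cl; congr lam.
  by rewrite {1}zE {1}zE'; ring.
move=> Aa /lamP[c [d [Ac Ad Ae zE]]].
rewrite -[RHS](lamE (a * c) (a * d)); cl; congr lam.
by rewrite {1}zE; ring.
Qed.

(* With [lam y] the coefficient of [y^2], [lattice k j y] is up to scaling the
   dual of [lattice (j - k) j y] for the pairing [lam y (u * v)], and two
   functionals [lam y], [lam y'] differ by multiplication by an element [c]. *)
Lemma lattice_dual_unique k j y y' : primitive y -> primitive y' -> (k <= j)%N ->
  lattice (j - k) j y = lattice (j - k) j y' ->
  exists2 c, c != 0 & lattice k j y = scale_set c (lattice k j y').
Proof.
move=> yP y'P le_kj eqL; have By : B y by case: yP.
have By' : B y' by case: y'P.
have [lam [lamA lamE lamD lamZ]] := top_coefficient_ex yP.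
have [lam' [lamA' lamE' lamD' lamZ']] := top_coefficient_ex y'P.
(* Dual description: z pairs with 1 and p^(j - k) z0 into p^j A exactly when l z is in p^j A and l
   (z0 z) in p^k A; p^j B always pairs into p^j A. *)
have lattice_lam z0 l : primitive z0 -> B z0 ->
    (forall c d e, A c -> A d -> A e -> l (c + d * z0 + e * z0 ^+ 2) = e) ->
    (forall z, B z -> A (l z)) ->
    (forall z z', B z -> B z' -> l (z + z') = l z + l z') ->
    (forall a z, A a -> B z -> l (a * z) = a * l z) ->
    forall z, B z -> lattice k j z0 z <-> pA j (l z) /\ pA k (l (z0 * z)).
  move=> z0P Bz0 lE lA lD lZ z /(quadratic_ex z0P) [c [d [e [Ac Ad Ae ->]]]].
  have A3 : A (l (z0 ^+ 3)) by apply: lA; cl.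
  have -> : l (z0 * (c + d * z0 + e * z0 ^+ 2)) = d + e * l (z0 ^+ 3).
    rewrite -[in RHS](lE 0 c d); cl; rewrite -lZ; cl; rewrite -lD; cl.
    by congr l; ring.
  rewrite lE // lattice_quadratic //.
  split=> -[pd pe]; split=> //.
    by rewrite mulrC; apply: pA_add => //; apply: pA_mull => //; apply: pA_le pe.
  have -> : d = (d + e * l (z0 ^+ 3)) - l (z0 ^+ 3) * e by ring.
  apply: pA_add => //; apply/pA_opp/pA_mull => //; exact: pA_le pd.
(* These values are forced by lam' z = lam (c z) at z = y and z = y^2; at z = 1 both sides
   vanish. *)
pose c1 := lam' y; pose c0 := lam' (y ^+ 2) - c1 * lam (y ^+ 3).
have Ac1 : A c1 by apply: lamA'.
have Ac0 : A c0.
  have A2 : A (lam' (y ^+ 2)) by apply: lamA'; cl.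
  have A3 : A (lam (y ^+ 3)) by apply: lamA; cl.
  by rewrite /c0; cl.
pose c := c0 + c1 * y; have Bc : B c by rewrite /c; cl.
have lam'1 : lam' 1 = 0.
  by rewrite -[RHS](lamE' 1 0); cl; congr lam'; ring.
have lam'y' : lam' y' = 0.
  by rewrite -[RHS](lamE' 0 1); cl; congr lam'; ring.
have lam'E z : B z -> lam' z = lam (c * z).
  move=> /(quadratic_ex yP) [a [b [e [Aa Ab Ae ->]]]].
  have -> : lam (c * (a + b * y + e * y ^+ 2)) =
      (c1 * b + c0 * e) + c1 * e * lam (y ^+ 3).
    rewrite -(lamE (c0 * a) (c1 * a + c0 * b) (c1 * b + c0 * e)); cl.
    rewrite -lamZ; cl; rewrite -lamD; cl.
    by congr lam; rewrite /c; ring.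
  have -> : lam' (a + b * y + e * y ^+ 2) = b * c1 + e * lam' (y ^+ 2).
    rewrite -[a]mulr1 lamD'; cl; rewrite lamD'; cl.
    rewrite (lamZ' a 1) // ?(lamZ' b y) // ?(lamZ' e (y ^+ 2)) //; cl.
    by rewrite lam'1 mulr0 add0r.
  by rewrite /c0; ring.
(* If c were in p B, all values of lam' would be in p A, but its value at y'^2 is 1. *)
have [c_neq0 BVc] : c != 0 /\ B c^-1.
  case: (B_unitVpB Bc) => // -[w Bw wE].
  have := lamE' 0 0 1 A0 A0 A1; rewrite mul0r !add0r mul1r lam'E; cl.
  rewrite -wE -mulrA lamZ; cl => l1.
  have Al : A (lam (w * y' ^+ 2)) by apply: lamA; cl.
  by case: (@pX_Bunit 1 1 (lam (w * y' ^+ 2))); rewrite ?invr1 ?oner_neq0 //; cl.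
(* Equality of the two rings says that y and y' span the same line of B / A modulo p^k. *)
have [e0 [e1 [w [Ae0 Ae1 Bw y'E]]]] : exists e0 e1 w,
    [/\ A e0, A e1, B w & y' = e0 + e1 * y + p ^+ k * w].
  have := lattice_gen (j - k) j y'; rewrite -eqL => -[d0 [d1 [w [Ad0 Ad1 Bw y'E]]]].
  have jE : p ^+ j = p ^+ (j - k) * p ^+ k by rewrite -exprD subnK.
  have [e0 Ae0 e0E] : pA (j - k) d0.
    apply: pA_pB => //; exists (y' - d1 * y - p ^+ k * w); cl.
    by rewrite !mulrBr y'E jE; ring.
  exists e0, d1, w; split=> //; apply: (mulfI (pX_neq0 (j - k))).
  by rewrite y'E -e0E jE; ring.
have key z : B z -> lattice k j y' z <-> lattice k j y (c * z).
  move=> Bz; have Bcz : B (c * z) by cl.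
  rewrite (lattice_lam y' lam') // (lattice_lam y lam) // lam'E //.
  rewrite lam'E; cl.
  have -> : c * (y' * z) = e0 * (c * z) + e1 * (y * (c * z)) + p ^+ k * (w * c * z).
    by rewrite y'E; ring.
  rewrite lamD; cl; rewrite lamD; cl.
  rewrite (lamZ e0) ?(lamZ e1) ?(lamZ (p ^+ k)); cl.
  have Awcz : A (lam (w * c * z)) by apply: lamA; cl.
  have Aycz : A (lam (y * (c * z))) by apply: lamA; cl.
  split=> -[pj pk]; split=> //; last first.
    apply: pA_add; last by exists (lam (w * c * z)).
    by apply: pA_add; apply: pA_mull => //; apply: pA_le pj.
  have pk' : pA k (e1 * lam (y * (c * z))).
    have -> : e1 * lam (y * (c * z)) = (e0 * lam (c * z) + e1 * lam (y * (c * z)) +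
      p ^+ k * lam (w * c * z)) - (e0 * lam (c * z) + p ^+ k * lam (w * c * z)).
      by ring.
    apply: pA_add => //; apply: pA_opp; apply: pA_add.
      by apply: pA_mull => //; apply: pA_le pj.
    by exists (lam (w * c * z)).
  (* The condition is empty for k = 0. For k > 0 a nonunit e1 would put y' in A + p B, so e1 can be
     divided out. *)
  case: (posnP k) => [-> |k_gt0]; first by exists (lam (y * (c * z))); rewrite // expr0 mul1r.
  case: (A_unitVpA Ae1) => [[e10 AVe1]|[d Ad dE]].
    by rewrite -[lam _](mulKf e10); apply: pA_mull.
  case: y'P => _ /(_ e0 (d * y + p ^+ k.-1 * w)); case; cl.
  by rewrite y'E -dE expr1 -{1}(prednK k_gt0) exprS; ring.
exists c => //; apply/seteqP; split=> [z yz|_ [z yz <-]]; last first.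
  by apply/key => //; apply: lattice_B yz.
have Bz := lattice_B By yz.
exists (c^-1 * z); last by rewrite mulVKf.
by apply/key; [cl|rewrite mulVKf].
Qed.

(** * Length and conductor of an order *)

Lemma lattice00 x : B x -> lattice 0 0 x = B.
Proof.
move=> Bx; apply/seteqP; split=> [|w Bw]; first exact: lattice_B.
by exists 0, 0, w; split; cl; ring.
Qed.

Lemma lattice_le i j i' j' x : B x -> (i' <= i)%N -> (j' <= j)%N ->
  lattice i j x `<=` lattice i' j' x.
Proof.
move=> Bx le_i le_j _ [c [d [w [Ac Ad Bw ->]]]].
exists c, (d * p ^+ (i - i')), (p ^+ (j - j') * w); split; cl.
by rewrite (pX_split le_i) (pX_split le_j); ring.
Qed.

(** The exponent of x is lowered to 0, then that of x^2, truncated subtraction making the switch at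
    n = a; in this order i <= j holds throughout. *)
Lemma lattice_chain a b x : primitive x -> (a <= b)%N ->
  strict_chain A (lattice a b x) B (a + b)
    (fun n => lattice (a - n) (b - (n - a)) x).
Proof.
move=> xP le_ab; have Bx : B x by case: xP.
split=> [| |n _|n lt_n]; first by rewrite subn0 sub0n subn0.
- have -> : (a - (a + b) = 0)%N by lia.
  have -> : (b - (a + b - a) = 0)%N by lia.
  exact: lattice00.
- exact: lattice_submodule.
split=> [|sub]; first by apply: lattice_le => //; lia.
have le_n1 : (a - n.+1 <= b - (n.+1 - a))%N by lia.
have le_n : (a - n <= b - (n - a))%N by lia.
have [lt_na|le_an] := ltnP n a.
  have : lattice (a - n.+1) (b - (n.+1 - a)) x (0 + p ^+ (a - n.+1) * x + 0 * x ^+ 2).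
    by apply/lattice_quadratic => //; cl; split; [exists 1|exists 0]; cl; ring.
  by move/sub/lattice_quadratic; case => //; cl => /pA_pX; lia.
have : lattice (a - n.+1) (b - (n.+1 - a)) x (0 + 0 * x + p ^+ (b - (n.+1 - a)) * x ^+ 2).
  by apply/lattice_quadratic => //; cl; split; [exists 0|exists 1]; cl; ring.
by move/sub/lattice_quadratic; case => //; cl => _ /pA_pX; lia.
Qed.

Lemma chain_le R C m L : strict_chain A R C m L ->
  forall k l, (k <= l <= m)%N -> L k `<=` L l.
Proof.
move=> [_ _ _ Lstrict] k l; elim: l => [|l IH] /andP[le_kl le_lm].
  by move: le_kl; rewrite leqn0 => /eqP ->.
move: le_kl; rewrite leq_eqVlt => /orP[/eqP -> //|lt_kl].
apply: (subset_trans (IH _)); first by rewrite -ltnS lt_kl ltnW.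
by have /properW := Lstrict _ le_lm.
Qed.

(* A module [M] between [lattice a b x] and [B] is determined, among those that
   contain it, by the minimal valuations of the coefficient of [x^2] in [M] and
   of the coefficient of [x] in the intersection of [M] with [A + A x]. *)
Lemma lattice_chain_bound a b x m L : primitive x -> (a <= b)%N ->
  strict_chain A (lattice a b x) B m L -> (m <= a + b)%N.
Proof.
move=> xP le_ab Lchain; have Bx : B x by case: xP.
have [L0 Lm Lsub Lstrict] := Lchain.
pose least (P : nat -> Prop) := xget 0%N [set n | P n /\ forall k, P k -> (n <= k)%N].
have leastP (P : nat -> Prop) n : P n ->
    P (least P) /\ forall k, P k -> (least P <= k)%N.
  move=> Pn; apply: (@xgetPex _ 0%N [set n | P n /\ forall k, P k -> (n <= k)%N]).
  by have [k Pk kP] := least_nat (ex_intro _ n Pn); exists k.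
pose P1 (M : set E) n := M (p ^+ n * x).
pose P2 (M : set E) n := exists2 c, A c & M (c * x + p ^+ n * x ^+ 2).
pose between (M : set E) := [/\ submodule A M, lattice a b x `<=` M & M `<=` B].
have P1a M : between M -> P1 M a.
  by move=> [_ LM _]; apply: LM; apply: lattice_gen.
have P2b M : between M -> P2 M b.
  move=> [_ LM _]; exists 0; cl; apply: LM; apply: lattice_pB.
  by exists (x ^+ 2); cl; ring.
have key M M' : between M -> between M' -> M `<` M' ->
    (least (P1 M') + least (P2 M') < least (P1 M) + least (P2 M))%N.
  move=> MP M'P [MM' nM'M].
  have [[Msub LM MB] [M'sub LM' M'B]] := (MP, M'P).
  have [[M0 MD MZ] [M'0 M'D M'Z]] := (Msub, M'sub).
  have [P1M P1Mmin] := leastP _ _ (P1a _ MP).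
  have [P2M P2Mmin] := leastP _ _ (P2b _ MP).
  have [P1M' P1Mmin'] := leastP _ _ (P1a _ M'P).
  have [P2M' P2Mmin'] := leastP _ _ (P2b _ M'P).
  have le1 : (least (P1 M') <= least (P1 M))%N by apply: P1Mmin'; apply: MM'.
  have le2 : (least (P2 M') <= least (P2 M))%N.
    by apply: P2Mmin'; case: P2M => c Ac Mc; exists c => //; apply: MM'.
  rewrite ltnNge; apply/negP => ge12.
  have e1 : least (P1 M') = least (P1 M) by lia.
  have e2 : least (P2 M') = least (P2 M) by lia.
  have AM c : A c -> M c by move=> Ac; apply: LM; apply: lattice_A.
  have linM c0 c1 : A c0 -> A c1 -> M' (c0 + c1 * x) -> M (c0 + c1 * x).
    move=> Ac0 Ac1 M'c; apply: (MD); first exact: AM.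
    have [->|c10] := eqVneq c1 0; first by rewrite mul0r.
    have [l [u [Au AVu u0 cE]]] := A_split AB Ac1 c10.
    have /P1Mmin' le_l : P1 M' l.
      rewrite /P1; have -> : p ^+ l * x = u^-1 * (c0 + c1 * x - c0).
        by rewrite cE; field.
      by apply: M'Z => //; apply: submodule_sub => //; apply: MM'; apply: AM.
    rewrite cE (pX_split le_l).
    have -> : p ^+ least (P1 M') * p ^+ (l - least (P1 M')) * u * x =
      (p ^+ (l - least (P1 M')) * u) * (p ^+ least (P1 M') * x) by ring.
    by apply: MZ; [cl|rewrite e1].
  apply: nM'M => z M'z; have [c0 [c1 [c2 [Ac0 Ac1 Ac2 zE]]]] := quadratic_ex xP (M'B _ M'z).
  have [c20|c20] := eqVneq c2 0.
    by move: M'z; rewrite zE c20 mul0r addr0; apply: linM.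
  have [l [u [Au AVu u0 cE]]] := A_split AB Ac2 c20.
  have /P2Mmin' le_l : P2 M' l.
    exists (u^-1 * c1); cl.
    have -> : u^-1 * c1 * x + p ^+ l * x ^+ 2 = u^-1 * (z - c0).
      by rewrite zE cE; field.
    by apply: M'Z => //; apply: submodule_sub => //; apply: MM'; apply: AM.
  (* Echelon reduction: a multiple of r, an element of M of least valuation at x^2, clears that
     coefficient of z. *)
  have [d Ad Md] := P2M; set r := d * x + _ in Md.
  pose e := p ^+ (l - least (P2 M')) * u; have Ae : A e by rewrite /e; cl.
  have zE' : c0 + (c1 - e * d) * x = z - e * r.
    by rewrite /r zE cE (pX_split le_l) /e e2; ring.
  have -> : z = (c0 + (c1 - e * d) * x) + e * r by rewrite zE'; ring.
  apply: (MD); last exact: MZ.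
  apply: linM; cl; rewrite zE'; apply: submodule_sub => //.
  by apply: M'Z => //; apply: MM'.
have betweenL k : (k <= m)%N -> between (L k).
  move=> le_km; split; first exact: Lsub.
    by rewrite -L0; apply: (chain_le Lchain); rewrite le_km.
  by rewrite -Lm; apply: (chain_le Lchain); rewrite le_km leqnn.
have phiL k : (k <= m)%N ->
    (least (P1 (L k)) + least (P2 (L k)) + k <= a + b)%N.
  elim: k => [_|k IH lt_km].
    rewrite addn0; apply: leq_add.
      by have [_] := leastP _ _ (P1a _ (betweenL _ (leq0n m))); apply; apply: P1a; apply: betweenL.
    by have [_] := leastP _ _ (P2b _ (betweenL _ (leq0n m))); apply; apply: P2b; apply: betweenL.
  have := key _ _ (betweenL _ (ltnW lt_km)) (betweenL _ lt_km) (Lstrict _ lt_km).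
  by have := IH (ltnW lt_km); lia.
by have := phiL m (leqnn m); lia.
Qed.

Lemma lattice_length a b x s : primitive x -> (a <= b)%N ->
  quotient_length A (lattice a b x) B s -> s = (a + b)%N.
Proof.
move=> xP le_ab [[L Ls] max_s]; apply/eqP; rewrite eqn_leq; apply/andP; split.
  exact: lattice_chain_bound Ls.
exact: max_s (lattice_chain xP le_ab).
Qed.

(** The bound b <= 2 a comes from (p^a x)^2, whose coefficient p^(2 a) at x^2 must be divisible by
    p^b. *)
Lemma order_lattice R n : subring R -> A `<=` R -> R `<=` B -> pB n `<=` R ->
  exists a b x, [/\ primitive x, (a <= b <= 2 * a)%N & R = lattice a b x].
Proof.
move=> [R1 RB RM] AR RsubB nR.
have R0 : R 0 by rewrite -(subrr 1); apply: RB.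
have Rsub : submodule A R.
  split=> // [u v Ru Rv|c u /AR]; last exact: RM.
  by rewrite -[v]opprK -[- v]sub0r; apply: (RB) => //; apply: RB.
have [a [b [x [xP le_ab RE]]]] := lattice_ex Rsub R1 RsubB nR.
exists a, b, x; split=> //; rewrite le_ab /=.
have : lattice a b x (0 + 0 * x + p ^+ (2 * a) * x ^+ 2).
  have Ru : R (p ^+ a * x) by rewrite RE; apply: lattice_gen.
  rewrite -RE; have -> : 0 + 0 * x + p ^+ (2 * a) * x ^+ 2 = (p ^+ a * x) * (p ^+ a * x).
    by rewrite mul2n -addnn exprD; ring.
  exact: RM.
by case/lattice_quadratic => //; cl => _ /pA_pX.
Qed.

Lemma lattice_conductor_eq a b f x : primitive x -> (a <= b)%N ->
  [set c | B c /\ forall z, B z -> lattice a b x (c * z)] = pB f -> b = f.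
Proof.
move=> xP le_ab fE; apply/eqP; rewrite eqn_leq; apply/andP; split.
  apply: (lattice_conductor xP le_ab) => z; rewrite -fE => -[_ /(_ 1 B1)].
  by rewrite mulr1.
have : pB f (p ^+ b).
  by rewrite -fE; split=> [|z Bz]; cl; apply: lattice_pB; exists z.
by move/(pA_pB (A_pX b)) => /pA_pX.
Qed.

(** * Overorders *)

(** [T n] lists representatives of A / p^n A by the numbers below q^n, so that lines can be indexed
    by ordinals of explicit size. *)
Definition digit_system (q : nat) (T : nat -> nat -> E) : Prop :=
  [/\ forall n d, A (T n d),
      forall n c, A c -> exists2 d, (d < q ^ n)%N & pA n (c - T n d)
    & forall n d d', (d < q ^ n)%N -> (d' < q ^ n)%N ->
        pA n (T n d - T n d') -> d = d'].

(** The base q digits of d, least significant first, become p-adic digits taken from the residue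
    representatives r. *)
Fixpoint digit_expansion (q : nat) (r : nat -> E) (n d : nat) : E :=
  if n is m.+1 then r (d %% q)%N + p * digit_expansion q r m (d %/ q) else 0.

Lemma digit_system_ex (q : nat) (r : nat -> E) :
  (forall k, (k < q)%N -> A (r k)) ->
  (forall c, A c -> exists2 k, (k < q)%N & pA 1 (c - r k)) ->
  (forall k l, (k < q)%N -> (l < q)%N -> pA 1 (r k - r l) -> k = l) ->
  digit_system q (digit_expansion q r).
Proof.
move=> rA r_ex r_inj; have Ap := A_p AB.
have q_gt0 : (0 < q)%N by have [k] := r_ex 0 A0; case: q {rA r_ex r_inj}.
have AT n d : A (digit_expansion q r n d).
  elim: n d => [|n IH] d /=; cl.
  by have := rA (d %% q)%N (ltn_pmod _ q_gt0); have := IH (d %/ q)%N; move=> *; cl.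
split=> //.
- elim=> [|n IH] c Ac; first by exists 0%N => //; exists c; cl; rewrite /= ; ring.
  have [k ltkq [c' Ac' c'E]] := r_ex c Ac.
  have [d ltd [e Ae eE]] := IH c' Ac'.
  exists (d * q + k)%N.
    by rewrite expnSr; have := leq_mul ltd (leqnn q); lia.
  exists e => //=; rewrite modnMDl modn_small // divnMDl // divn_small // addn0.
  by rewrite exprS -mulrA eE mulrBr -[p * c']/(p ^+ 1 * c') c'E; ring.
- elim=> [|n IH] d d'; first by case: d d' => [|[]] // [|[]].
  move=> ltd ltd' /= pdd.
  have eqm : (d %% q = d' %% q)%N.
    apply: r_inj; rewrite ?ltn_pmod //.
    set D := digit_expansion q r n (d %/ q) in pdd *.
    set D' := digit_expansion q r n (d' %/ q) in pdd *.
    have -> : r (d %% q)%N - r (d' %% q)%N =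
       (r (d %% q)%N + p * D - (r (d' %% q)%N + p * D')) + p ^+ 1 * (D' - D) by ring.
    apply: pA_add; first exact: (pA_le (ltn0Sn n) pdd).
    by exists (D' - D) => //; apply: A_sub; apply: AT.
  rewrite (divn_eq d q) (divn_eq d' q) eqm; congr (_ * q + _)%N.
  apply: IH; rewrite ?ltn_divLR // -?expnSr //.
  apply: (@pA_shift 1); rewrite add1n.
  move: pdd; rewrite eqm; congr (scale_set _ A _); rewrite expr1; ring.
Qed.

Section Overorders.
Variables (q : nat) (T : nat -> nat -> E).
Hypothesis TP : digit_system q T.

Lemma T_A n d : A (T n d). Proof. by case: TP. Qed.
#[local] Hint Resolve T_A : closure.

(* Representatives of the lines of [B / A] modulo [p ^ (j - i)] that can occur
   in overorders [lattice i j y] of [lattice a b x]. *)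
Definition slope a i j (vertical : bool) d x : E :=
  if vertical then p * T (j - i - 1) d * x + x ^+ 2
  else x + p ^+ (j - a) * T (minn j a - i) d * x ^+ 2.

(** On a nonvertical line x + t x^2, the condition that p^a x lies in the lattice means i <= a and t
    in p^(j - a) A, with t taken modulo p^(j - i). Vertical lines c x + x^2 have c in p A and
    satisfy it only if j <= a. For i = j the single line is counted as nonvertical. *)
Definition slope_count a i j (vertical : bool) : nat :=
  if vertical then (if i < j <= a then q ^ (j - i - 1) else 0)%N
  else (if i <= a then q ^ (minn j a - i) else 0)%N.

Lemma slope_quadratic a i j k d x : exists c e,
  [/\ A c, A e, slope a i j k d x = c * x + e * x ^+ 2 &
      if k then c = p * T (j - i - 1) d /\ e = 1
      else c = 1 /\ e = p ^+ (j - a) * T (minn j a - i) d].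
Proof.
have Ap := A_p AB; case: k.
  by exists (p * T (j - i - 1) d), 1; split=> //; cl; rewrite /slope mul1r.
exists 1, (p ^+ (j - a) * T (minn j a - i) d).
by split=> //; cl; rewrite /slope mul1r.
Qed.

Lemma slope_primitive a i j k d x : primitive x -> primitive (slope a i j k d x).
Proof.
move=> xP; have [c [e [Ac Ae -> ceE]]] := slope_quadratic a i j k d x.
rewrite -[c * x]add0r; apply/primitive_quadratic => //; cl => -[pc pe].
by case: k ceE => -[cE eE]; [move: pe; rewrite eE|move: pc; rewrite cE];
  move/not_pA_unit; rewrite invr1 oner_neq0 => /(_ isT A1).
Qed.

(** The coordinates of p^a x = c + d p^i y + p^j w yield the constraints on y = e0 + e1 x + e2 x^2;
    y is then normalized by e1 if this is a unit, and otherwise by e2, a unit because y is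
    primitive. *)
Lemma overorder_ex a b i j x y : primitive x -> primitive y ->
  (a <= b)%N -> (i <= j)%N -> lattice a b x `<=` lattice i j y ->
  (j <= b)%N /\ exists k d, (d < slope_count a i j k)%N /\
    lattice i j y = lattice i j (slope a i j k d x).
Proof.
move=> xP yP le_ab le_ij sub; have Bx : B x by case: xP.
have le_jb : (j <= b)%N.
  by apply: (lattice_conductor yP le_ij) => z /lattice_pB /sub.
split=> //; have By : B y by case: yP.
have [e0 [e1 [e2 [Ae0 Ae1 Ae2 yE]]]] := quadratic_ex xP By.
have [c [d [w [Ac Ad Bw xE]]]] := sub _ (lattice_gen a b x).
have [w0 [w1 [w2 [Aw0 Aw1 Aw2 wE]]]] := quadratic_ex xP Bw.
have [|||||||_ E1 E2] := @quadratic_eq x 0 (p ^+ a) 0 (c + d * p ^+ i * e0 + p ^+ j * w0)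
   (d * p ^+ i * e1 + p ^+ j * w1) (d * p ^+ i * e2 + p ^+ j * w2) xP; cl.
  by transitivity (p ^+ a * x); [ring|rewrite xE yE wE; ring].
have le_ia : (i <= a)%N.
  by apply: pA_pX; exists (d * e1 + p ^+ (j - i) * w1); cl; rewrite E1 (pX_split le_ij); ring.
(* For i = j all lines agree modulo p^0. *)
move: le_ij; rewrite leq_eqVlt => /orP[/eqP eq_ij|lt_ij].
  exists false, 0%N; split; first by rewrite /slope_count le_ia -eq_ij (minn_idPl _) // subnn.
  have [Bs _] := slope_primitive a i j false 0 xP.
  apply: (@lattice_change _ _ _ _ 0 1 (y - slope a i j false 0 x)); cl.
  - by rewrite eq_ij.
  - by rewrite invr1; cl.
  - exact: oner_neq0.
  - by rewrite eq_ij subnn expr0; ring.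
have le_ij := ltnW lt_ij.
have [_ T_ex _] := TP.
case: (A_unitVpA Ae1) => [[e10 AVe1]|[f Af fE]].
  have pt : pA (j - a) (e2 * e1^-1).
    have [le_ja|lt_aj] := leqP j a.
      have -> : (j - a = 0)%N by lia.
      by exists (e2 * e1^-1); cl; ring.
    apply: (@pA_shift a); rewrite subnKC ?(ltnW lt_aj) //.
    exists (e2 * e1^-1 * w1 - w2); cl.
    have dE : d * p ^+ i * e2 = - (p ^+ j * w2).
      by apply/eqP; rewrite -subr_eq0 opprK -E2.
    rewrite E1; transitivity (e2 * e1^-1 * (p ^+ j * w1) + d * p ^+ i * e2); last by field.
    by rewrite dE; ring.
  have [t At tE] := pt; have [u ltu [v Av vE]] := T_ex (minn j a - i)%N t At.
  exists false, u; split; first by rewrite /slope_count le_ia.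
  apply: (@lattice_change _ _ _ _ e0 e1 (e1 * v * x ^+ 2)) => //; cl.
  have -> : (j - i = (j - a) + (minn j a - i))%N by lia.
  have e2E : e2 = e1 * (p ^+ (j - a) * t) by rewrite tE; field.
  rewrite yE /slope exprD e2E.
  have -> : t = p ^+ (minn j a - i) * v + T (minn j a - i) u by rewrite vE; ring.
  by ring.
case: (A_unitVpA Ae2) => [[e20 AVe2]|pe2]; last first.
  have [] := primitive_quadratic xP Ae0 Ae1 Ae2; rewrite -yE => /(_ yP) + _.
  by case; split=> //; exists f.
have le_ja : (j <= a)%N.
  apply: pA_pX; exists (w1 - w2 * e2^-1 * e1); cl.
  have dE : d * p ^+ i = - (p ^+ j * w2) * e2^-1.
    apply: (mulIf e20); rewrite mulfVK //.
    by apply/eqP; rewrite -subr_eq0 opprK -E2.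
  by rewrite E1 dE; ring.
have Af2 : A (f * e2^-1) by cl.
have [u ltu [v Av vE]] := T_ex (j - i - 1)%N _ Af2.
exists true, u; split; first by rewrite /slope_count lt_ij le_ja.
have Ap := A_p AB.
apply: (@lattice_change _ _ _ _ e0 e2 (e2 * v * x)) => //; cl.
have -> : p ^+ (j - i) = p * p ^+ (j - i - 1).
  by rewrite -exprS; congr (_ ^+ _); lia.
rewrite yE /slope -fE.
have -> : f = e2 * (p ^+ (j - i - 1) * v + T (j - i - 1) u) by rewrite vE; field.
by ring.
Qed.

Lemma overorder_sub a b i j k d x : primitive x -> (i <= j <= b)%N ->
  (d < slope_count a i j k)%N ->
  lattice a b x `<=` lattice i j (slope a i j k d x).
Proof.
move=> xP /andP[le_ij le_jb] ltd _ [c [e [w [Ac Ae Bw ->]]]].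
have Bx : B x by case: xP.
have [L0 LD LZ] := lattice_submodule i j (slope a i j k d x).
apply: (LD); last first.
  by apply: lattice_pB; exists (p ^+ (b - j) * w); cl; rewrite (pX_split le_jb); ring.
apply: (LD); first exact: lattice_A.
apply: LZ => //; have [le_ja|lt_aj] := leqP j a.
  by apply: lattice_pB; exists (p ^+ (a - j) * x); cl; rewrite (pX_split le_ja); ring.
case: k ltd {L0 LD} => /=; rewrite /slope_count; first by rewrite [(j <= a)%N]leqNgt lt_aj andbF.
case: (leqP i a) => // le_ia _.
exists 0, (p ^+ (a - i)), (- (T (minn j a - i) d * x ^+ 2)); split; cl.
rewrite /slope [p ^+ j](pX_split (ltnW lt_aj)) (pX_split le_ia); ring.
Qed.

Lemma lattice_same_line i j x c e c' e' : primitive x -> (i <= j)%N ->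
  A c -> A e -> A c' -> A e' ->
  lattice i j (c * x + e * x ^+ 2) = lattice i j (c' * x + e' * x ^+ 2) ->
  exists u w1 w2, [/\ A u, A w1, A w2, c = u * c' + p ^+ (j - i) * w1 &
     e = u * e' + p ^+ (j - i) * w2].
Proof.
move=> xP le_ij Ac Ae Ac' Ae' eqL; have Bx : B x by case: xP.
have := lattice_gen i j (c * x + e * x ^+ 2); rewrite eqL => -[d [u [w [Ad Au Bw wE]]]].
have [w0 [w1 [w2 [Aw0 Aw1 Aw2 w'E]]]] := quadratic_ex xP Bw.
have [|||||||_ E1 E2] := @quadratic_eq x 0 (p ^+ i * c) (p ^+ i * e) (d + p ^+ j * w0)
   (u * p ^+ i * c' + p ^+ j * w1) (u * p ^+ i * e' + p ^+ j * w2) xP; cl.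
  transitivity (p ^+ i * (c * x + e * x ^+ 2)); first by ring.
  by rewrite wE w'E; ring.
exists u, w1, w2; split=> //; apply: (mulfI (pX_neq0 i)).
  by rewrite E1 (pX_split le_ij); ring.
by rewrite E2 (pX_split le_ij); ring.
Qed.

(** The coordinate normalized to 1 forces u = 1 modulo p^(j - i), so the other coordinates agree
    modulo p^(j - i). Slopes of different kinds would make 1 divisible by p when i < j. *)
Lemma overorder_inj a i j k k' d d' x : primitive x -> (i <= j)%N ->
  (d < slope_count a i j k)%N -> (d' < slope_count a i j k')%N ->
  lattice i j (slope a i j k d x) = lattice i j (slope a i j k' d' x) ->
  k = k' /\ d = d'.
Proof.
move=> xP le_ij; have [_ _ T_inj] := TP; have Ap := A_p AB.
have mixed d1 d2 : (i < j)%N ->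
    lattice i j (slope a i j false d1 x) <> lattice i j (slope a i j true d2 x).
  have [c [e [Ac Ae -> [cE _]]]] := slope_quadratic a i j false d1 x.
  have [c' [e' [Ac' Ae' -> [cE' _]]]] := slope_quadratic a i j true d2 x.
  move=> lt_ij /(lattice_same_line xP le_ij Ac Ae Ac' Ae').
  rewrite cE cE' => -[u [w [_ [Au Aw _ E1 _]]]].
  apply: (@pX_Bunit 1 1 (u * T (j - i - 1) d2 + p ^+ (j - i - 1) * w));
    rewrite ?invr1 ?oner_neq0 //; cl.
  have jiE : (j - i = 1 + (j - i - 1))%N by lia.
  rewrite {1}E1 {2}jiE exprD; ring.
rewrite /slope_count; case: k k' => -[].
- case: (boolP (i < j <= a)%N) => // /andP[lt_ij le_ja] ltd ltd'.
  have [c [e [Ac Ae -> [cE eE]]]] := slope_quadratic a i j true d x.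
  have [c' [e' [Ac' Ae' -> [cE' eE']]]] := slope_quadratic a i j true d' x.
  move=> /(lattice_same_line xP le_ij Ac Ae Ac' Ae') [u [w1 [w2 [Au Aw1 Aw2 E1 E2]]]].
  split=> //; apply: T_inj ltd ltd' _; apply: (@pA_shift 1).
  rewrite (_ : 1 + (j - i - 1) = j - i)%N; last by lia.
  rewrite mulrBr expr1 -cE -cE' E1.
  move: E2; rewrite eE eE' mulr1 => E2; exists (w1 - w2 * c'); cl.
  have -> : u = 1 - p ^+ (j - i) * w2 by rewrite E2; ring.
  by ring.
- case: (boolP (i < j <= a)%N) => // /andP[lt_ij le_ja] _ _ /esym.
  by move/mixed => /(_ lt_ij).
- case: (boolP (i < j <= a)%N) => // /andP[lt_ij le_ja] _ _.
  by move/mixed => /(_ lt_ij).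
- case: (leqP i a) => // le_ia ltd ltd'.
  have [c [e [Ac Ae -> [cE eE]]]] := slope_quadratic a i j false d x.
  have [c' [e' [Ac' Ae' -> [cE' eE']]]] := slope_quadratic a i j false d' x.
  move=> /(lattice_same_line xP le_ij Ac Ae Ac' Ae') [u [w1 [w2 [Au Aw1 Aw2 E1 E2]]]].
  split=> //; apply: T_inj ltd ltd' _; apply: (@pA_shift (j - a)).
  rewrite (_ : (j - a) + (minn j a - i) = j - i)%N; last by lia.
  rewrite mulrBr -eE -eE' E2; move: E1; rewrite cE cE' mulr1 => E1.
  exists (w2 - w1 * e'); cl.
  have -> : u = 1 - p ^+ (j - i) * w1 by rewrite E1; ring.
  by ring.
Qed.

(** * Ideal classes *)

Lemma lattice_fractional_ideal R k j y : primitive y -> (k <= j)%N ->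
  subring R -> A `<=` R -> submodule R (lattice k j y) ->
  fractional_ideal R (lattice k j y).
Proof.
move=> yP le_kj [R1 _ _] AR Lsub; have [L0 LD LZ] := Lsub; split=> //; last first.
  move=> L00; have : lattice k j y 1 by apply: lattice_A; cl.
  by rewrite L00 => /eqP; rewrite oner_eq0.
have By : B y by case: yP.
exists [:: 1; p ^+ k * y; p ^+ j * y ^+ 2]; apply/seteqP; split=> z.
  move=> Lz; have [c [d [e [Ac Ad Ae zE]]]] := quadratic_ex yP (lattice_B By Lz).
  move: Lz; rewrite zE => /(lattice_quadratic yP Ac Ad Ae le_kj) [[d' Ad' dE] [e' Ae' eE]].
  exists 3%N, (fun i : 'I_3 => nth 0 [:: c; d'; e'] i),
    (fun i : 'I_3 => nth 0 [:: 1; p ^+ k * y; p ^+ j * y ^+ 2] i); split.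
  - by case=> -[|[|[|]]] //= _; apply: AR.
  - by case=> -[|[|[|]]] //= _; rewrite !inE eqxx ?orbT.
  - by rewrite !big_ord_recl big_ord0 /= -dE -eE; ring.
move=> [n [r [g [Rr gP ->]]]]; elim/big_ind: _ => // i _; apply: LZ => //.
have := gP i; rewrite /= !inE => /or3P[]/eqP ->.
- by apply: lattice_A; cl.
- exact: lattice_gen.
- by apply: lattice_pB; exists (y ^+ 2); cl.
Qed.

Lemma scale_setM (u v : E) (M : set E) : scale_set u (scale_set v M) = scale_set (u * v) M.
Proof.
apply/seteqP; split=> [_ [_ [z Mz <-] <-]|_ [z Mz <-]].
  by exists z; rewrite // mulrA.
by exists (v * z); [exists z|rewrite mulrA].
Qed.

Lemma scale_set1 (M : set E) : scale_set 1 M = M.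
Proof.
by apply/seteqP; split=> [_ [z Mz <-]|z Mz]; rewrite ?mul1r //; exists z; rewrite ?mul1r.
Qed.

Lemma scale_set_submodule (R : set E) (u : E) (M : set E) : submodule R M -> submodule R (scale_set u M).
Proof.
move=> [M0 MD MZ]; split.
- by exists 0; rewrite ?mulr0.
- by move=> _ _ [z Mz <-] [z' Mz' <-]; exists (z + z'); [apply: MD|rewrite mulrDr].
- by move=> c _ Rc [z Mz <-]; exists (c * z); [apply: MZ|rewrite mulrCA].
Qed.

Lemma ideal_class_scale (R : set E) (u : E) (I : set E) : u != 0 ->
  ideal_class R (scale_set u I) = ideal_class R I.
Proof.
move=> u0; apply/seteqP; split=> J [JP [v v0 JE]]; split; rewrite // JE.
  by exists (v * u); rewrite ?mulf_neq0 // scale_setM.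
by exists (v / u); rewrite ?mulf_neq0 ?invr_neq0 // scale_setM mulfVK.
Qed.

Lemma ideal_class_eq (R I J : set E) : fractional_ideal R I ->
  ideal_class R I = ideal_class R J -> exists2 u, u != 0 & I = scale_set u J.
Proof.
move=> IP eqIJ; have : ideal_class R I I.
  by split=> //; exists 1; rewrite ?oner_neq0 ?scale_set1.
by rewrite eqIJ => -[_].
Qed.

(** The ideal is divided by an element of least valuation; p^N first moves it into [B], where
    [B_split] reads off valuations. *)
Lemma ideal_normalize (R I : set E) : R `<=` B -> fractional_ideal R I ->
  exists2 u, u != 0 & scale_set u I 1 /\ scale_set u I `<=` B.
Proof.
move=> RsubB [[I0 ID IZ] [gens IE] Inz].
have [N NP] : exists N, forall g, g \in gens -> B (p ^+ N * g).
  elim: gens {IE} => [|g gens [N NP]]; first by exists 0%N.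
  have [n nP] := B_denominator AB g; exists (N + n)%N => h.
  rewrite inE => /orP[/eqP ->|/NP Nh]; first by rewrite exprD -mulrA; cl.
  by rewrite exprD mulrAC [_ * p ^+ n]mulrC; cl.
have NI z : I z -> B (p ^+ N * z).
  rewrite IE => -[n [r [g [Rr gP ->]]]]; rewrite mulr_sumr.
  elim/big_ind: _ => [||i _]; [exact: B0|exact: B_add|].
  by rewrite mulrCA; apply: B_mul; [exact: RsubB|apply: NP; apply: gP].
have [z Iz z0] : exists2 z, I z & z != 0.
  apply: contrapT => noz; apply: Inz; apply/seteqP; split=> [z Iz|_ -> //].
  by apply/eqP; apply: contrapT => z0; apply: noz; exists z => //; apply/negP.
pose P n := exists z u, [/\ I z, B u, B u^-1, u != 0 & p ^+ N * z = p ^+ n * u].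
have split_I w : I w -> w != 0 -> exists n u,
    [/\ B u, B u^-1, u != 0 & p ^+ N * w = p ^+ n * u].
  by move=> Iw w0; apply: (B_split AB); [exact: NI|rewrite mulf_neq0].
have [|n [w [u [Iw Bu BVu u0 wE]]] n_min] := @least_nat P.
  by have [n [u [? ? ? ?]]] := split_I z Iz z0; exists n, z, u.
exists (p ^+ N / (p ^+ n * u)); first by rewrite mulf_neq0 ?invr_neq0 ?mulf_neq0.
split=> [|_ [v Iv <-]].
  by exists w => //; rewrite mulrAC wE mulfV ?mulf_neq0.
have [->|v0] := eqVneq v 0; first by rewrite mulr0; apply: B0.
have [m [t [Bt BVt t0 vE]]] := split_I v Iv v0.
have le_nm : (n <= m)%N by apply: n_min; exists v, t.
have -> : p ^+ N / (p ^+ n * u) * v = p ^+ (m - n) * t * u^-1.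
  by rewrite mulrAC vE (pX_split le_nm); field; rewrite u0 pX_neq0.
by cl.
Qed.

(** 0 and 1 differ modulo p. The bound makes Q - 1 nonzero in the closed formula. *)
Lemma digit_system_base : (1 < q)%N.
Proof.
have [_ T_ex _] := TP; have [d ltd pd] := T_ex 1%N 0 A0; have [d' ltd' pd'] := T_ex 1%N 1 A1.
rewrite ltnNge; apply/negP => le_q1; move: ltd ltd'; rewrite expn1 => ltd ltd'.
have eqd : d = d' by lia.
have : pA 1 (p ^+ 0).
  have -> : p ^+ 0 = (1 - T 1 d') - (0 - T 1 d) by rewrite eqd expr0; ring.
  by apply: pA_add => //; apply: pA_opp.
by move/pA_pX.
Qed.

(** * Indexing the ideal classes of an order by its overorders *)

Section Classification.
Variables (a b : nat) (x : E).
Hypotheses (xP : primitive x) (abP : (a <= b <= 2 * a)%N).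
Local Notation R := (lattice a b x).

Let Bx : B x. Proof. by case: xP. Qed.
Let le_ab : (a <= b)%N. Proof. by case/andP: abP. Qed.
Let Rring : subring R. Proof. exact: lattice_subring. Qed.
Let RsubB : R `<=` B. Proof. exact: lattice_B. Qed.
Let AR : A `<=` R. Proof. exact: lattice_A. Qed.

(* The last component selects, for a ring [S = lattice i j y], either the class
   of [S] or, if [j < 2 * i], that of the dual [lattice (j - i) j y] of [S]. *)
Definition class_count (u : 'I_b.+1 * 'I_b.+1 * bool * bool) : nat :=
  let: (i, j, k, dual) := u in
  if (i <= j <= 2 * i)%N && (dual ==> (j < 2 * i)%N) then slope_count a i j k else 0%N.

Definition class_index := {u : 'I_b.+1 * 'I_b.+1 * bool * bool & 'I_(class_count u)}.

Definition index_lattice (t : class_index) : set E :=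
  let: existT (i, j, k, dual) d := t in
  lattice (if dual then j - i else i)%N j (slope a i j k d x).

Definition index_ring (t : class_index) : set E :=
  let: existT (i, j, k, dual) d := t in lattice i j (slope a i j k d x).

Lemma class_countP (i j : 'I_b.+1) k dual (d : 'I_(class_count (i, j, k, dual))) :
  [/\ (i <= j <= 2 * i)%N, dual ==> (j < 2 * i)%N & (d < slope_count a i j k)%N].
Proof.
by case: d => d /=; case: ifP => // /andP[].
Qed.

(** The dual of S has multiplier ring S again, so the ring is recovered from the class for either
    value of [dual]. *)
Lemma index_multiplier t : multiplier (index_lattice t) = index_ring t.
Proof.
case: t => -[[[i j] k] dual] d; have [ijP dP ltd] := class_countP d => /=.
have sP := slope_primitive a i j k d xP; have [Bs _] := sP.
case: dual d dP ltd sP Bs => d dP ltd sP Bs; last first.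
  by apply: multiplier_subring; apply: lattice_subring.
rewrite multiplier_lattice //; last by lia.
by congr (lattice _ _ _); lia.
Qed.

Lemma index_ring_sup t : R `<=` index_ring t.
Proof.
case: t => -[[[i j] k] dual] d; have [ijP dP ltd] := class_countP d => /=.
by apply: overorder_sub => //; have := ltn_ord j; lia.
Qed.

Lemma index_fractional_ideal t : fractional_ideal R (index_lattice t).
Proof.
have : forall c z, R c -> index_lattice t z -> index_lattice t (c * z).
  move=> c z Rc; have : index_ring t c by apply: index_ring_sup.
  by rewrite -index_multiplier; apply.
case: t => -[[[i j] k] dual] d; have [ijP dP ltd] := class_countP d => /=.
move=> Rmul; apply: lattice_fractional_ideal => //.
- exact: slope_primitive.
- by case: dual {dP Rmul d ltd}; lia.
- by have [] := lattice_submodule (if dual then j - i else i)%N j (slope a i j k d x).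
Qed.

(* If [D = c S] with [S = lattice i j y] and [D = lattice (j - i) j y], then
   [c^-1] lies in [S], and [c^-1 p^(j - i) y] in [S] forces [c^-1] into [p B],
   whereas [c] lies in [D], hence in [B]. *)
Lemma lattice_not_principal i j y c : primitive y -> (i <= j < 2 * i)%N -> c != 0 ->
  lattice (j - i) j y <> scale_set c (lattice i j y).
Proof.
move=> yP ijP c0 eqL; have By : B y by case: yP.
have le_ij : (i <= j)%N by lia.
have inS z : lattice (j - i) j y z -> lattice i j y (c^-1 * z).
  by rewrite eqL => -[w Sw <-]; rewrite mulKf.
have Bc : B c.
  apply: (@lattice_B (j - i) j y) => //; rewrite eqL; exists 1; rewrite ?mulr1 //.
  by apply: lattice_A; cl.
have := inS 1 (lattice_A _ _ _ A1); rewrite mulr1 => -[d [e [w [Ad Ae Bw cE]]]].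
have [L0 LD LZ] := lattice_submodule i j y.
have : lattice i j y (0 + p ^+ (j - i) * d * y + 0 * y ^+ 2).
  have -> : 0 + p ^+ (j - i) * d * y + 0 * y ^+ 2 = c^-1 * (p ^+ (j - i) * y)
      - p ^+ j * (e * y ^+ 2 + w * p ^+ (j - i) * y).
    have jE : p ^+ j = p ^+ (j - i) * p ^+ i by rewrite -exprD subnK.
    by rewrite cE mulrDl mulrDl -mulrA [p ^+ j * w]mulrC jE; ring.
  apply: submodule_sub; [exact: lattice_submodule|by apply: inS; apply: lattice_gen|].
  by apply: lattice_pB; exists (e * y ^+ 2 + w * p ^+ (j - i) * y); cl.
case/lattice_quadratic => //; cl.
rewrite {1}(_ : i = (j - i) + (2 * i - j))%N; last by lia.
move/pA_shift => /(@pA_le 1) => -[|f Af fE _]; first by lia.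
have i_gt0 : (0 < i)%N by lia.
have j_gt0 : (0 < j)%N by lia.
apply: (@pX_Bunit 1 1 (c * (f + e * p ^+ i.-1 * y + p ^+ j.-1 * w)));
  rewrite ?invr1 ?oner_neq0 //; cl.
rewrite -[LHS](mulfV c0) cE -fE -[in p ^+ i](prednK i_gt0) -[in p ^+ j](prednK j_gt0).
by rewrite !exprS expr0; ring.
Qed.

(** Equal classes have equal multiplier rings, which determine i, j, k and d. Only [dual] remains,
    and [lattice_not_principal] separates its values, applied to c or to its inverse. *)
Lemma index_class_inj : {in [set: class_index] &, injective (fun t => ideal_class R (index_lattice t))}.
Proof.
move=> t t' _ _ /(ideal_class_eq (index_fractional_ideal t)) [c c0 eqL].
have := congr1 multiplier eqL; rewrite multiplier_scale // !index_multiplier.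
move: eqL; case: t => -[[[i j] k] dual] d; case: t' => -[[[i' j'] k'] dual'] d'.
have [ijP dP ltd] := class_countP d; have [ijP' dP' ltd'] := class_countP d'.
have sP := slope_primitive a i j k d xP; have sP' := slope_primitive a i' j' k' d' xP.
move=> /= eqL eqS.
have [eqi eqj] : nat_of_ord i = i' /\ nat_of_ord j = j'.
  by apply: lattice_inj eqS => //; lia.
move/val_inj: eqi => eqi; move/val_inj: eqj => eqj.
subst i' j'.
have [|eqk eqd] := overorder_inj xP _ ltd ltd' eqS; first by lia.
subst k'.
have eqs : slope a i j k d x = slope a i j k d' x by rewrite /slope eqd.
have eqdual : dual = dual'.
  case: dual dual' d d' dP dP' ltd ltd' sP sP' eqL eqS eqd eqs => -[] //.
    move=> d d' dP _ _ _ sP sP' eqL _ _ eqs; case: (@lattice_not_principal i j _ c sP) => //.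
      by lia.
    by rewrite eqL eqs.
  move=> d d' _ dP _ _ sP sP' eqL _ _ eqs.
  case: (@lattice_not_principal i j _ c^-1 sP); rewrite ?invr_eq0 //; first by lia.
  by rewrite eqL scale_setM mulVf // scale_set1 eqs.
subst dual'; congr existT; exact: val_inj.
Qed.

Lemma index_class_surj C : ideal_class_monoid R C ->
  exists t, C = ideal_class R (index_lattice t).
Proof.
move=> [I IP <-]; have [Isub _ _] := IP.
have [u u0 [J1 JB]] := ideal_normalize RsubB IP.
rewrite -(ideal_class_scale R I u0).
have [J0 JD JZ] := scale_set_submodule u Isub.
set J := scale_set u I in J1 JB J0 JD JZ *.
have JA : submodule A J by split=> // c z /AR; apply: JZ.
have RJ : R `<=` J by move=> c Rc; rewrite -[c]mulr1; apply: JZ.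
have [|i [j [y [yP le_ij JE]]]] := lattice_ex JA J1 JB (n := b).
  by apply: (subset_trans _ RJ); apply: lattice_pB.
have By : B y by case: yP.
have [ijP|ijP] := leqP j (2 * i).
  have [|le_jb [k [d [ltd SE]]]] := overorder_ex xP yP le_ab le_ij; first by rewrite -JE.
  have lti : (i < b.+1)%N by lia.
  have ltd' : (d < class_count (Ordinal lti, Ordinal (le_jb : j < b.+1)%N, k, false))%N.
    by rewrite /= le_ij ijP.
  exists (existT _ (Ordinal lti, Ordinal (le_jb : j < b.+1)%N, k, false) (Ordinal ltd')).
  by rewrite JE SE.
(* The multiplier ring has exponents j - i and j, and its condition j < 2 (j - i) is 2 i < j; the
   self-dual case j = 2 i belongs to the branch of rings. *)
have le_iij : (2 * i <= j)%N by lia.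
have [||le_jb [k [d [ltd SE]]]] := @overorder_ex a b (j - i) j x y xP yP le_ab.
- by lia.
- rewrite -multiplier_lattice // -JE => c Rc z Jz; exact: JZ.
have lti : (j - i < b.+1)%N by lia.
have ltd' : (d < class_count (Ordinal lti, Ordinal (le_jb : j < b.+1)%N, k, true))%N.
  rewrite /= leq_subr (_ : j <= 2 * (j - i))%N; last by lia.
  by rewrite (_ : j < 2 * (j - i))%N //; lia.
exists (existT _ (Ordinal lti, Ordinal (le_jb : j < b.+1)%N, k, true) (Ordinal ltd')).
rewrite /= subKn // JE.
have [|c c0 ->] := lattice_dual_unique yP (slope_primitive a (j - i) j k d xP) _ SE => //.
exact: ideal_class_scale.
Qed.

Lemma ideal_class_monoid_card :
  ideal_class_monoid R #= `I_(\sum_u class_count u)%N.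
Proof.
have -> : ideal_class_monoid R =
    (fun t => ideal_class R (index_lattice t)) @` [set: class_index].
  apply/seteqP; split=> [C /index_class_surj[t ->]|_ [t _ <-]]; first by exists t.
  by exists (index_lattice t) => //; apply: index_fractional_ideal.
apply: card_eq_trans (inj_card_eq index_class_inj) _.
have -> : (\sum_u class_count u)%N = #|{: class_index}|.
  by rewrite card_tagged sumnE big_map big_enum; apply: eq_bigr => u _; rewrite card_ord.
apply/pcard_eqP/bijPex; exists (fun t : class_index => nat_of_ord (enum_rank t)).
split=> [t _ /=|t t' _ _ /val_inj|n /= ltn]; first exact: ltn_ord.
  exact: enum_rank_inj.
by exists (enum_val (Ordinal ltn)); rewrite ?enum_valK.
Qed.

End Classification.
End Overorders.
End CubicPair.

(** * Unramified cubic extensions of local fields *)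

Section Valuation.
Variables (F : fieldType) (v : F -> int) (q : nat).
Hypothesis LF : local_field v q.

Lemma val1 : v 1 = 0.
Proof.
have := Defs.valM LF (oner_neq0 F) (oner_neq0 F); rewrite mulr1 => /eqP.
by rewrite -subr_eq0 opprD addNKr oppr_eq0 => /eqP.
Qed.

Lemma valV x : x != 0 -> v x^-1 = - v x.
Proof.
move=> x0; apply/eqP; rewrite -subr_eq0 opprK.
by rewrite -(Defs.valM LF) ?invr_neq0 // mulVf // val1.
Qed.

Lemma valX x n : x != 0 -> v (x ^+ n) = v x *+ n.
Proof.
move=> x0; elim: n => [|n IH]; first by rewrite val1.
by rewrite exprS (Defs.valM LF) ?expf_neq0 // IH mulrS.
Qed.

Lemma vgeE n x : (x \in vge v n) = (x == 0) || (n <= v x).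
Proof. by []. Qed.

Lemma vge0 n : 0 \in vge v n.
Proof. by rewrite vgeE eqxx. Qed.

Lemma vge_mul m n x y : x \in vge v m -> y \in vge v n -> x * y \in vge v (m + n).
Proof.
rewrite !vgeE mulf_eq0; have [//|x0 /=] := eqVneq x 0.
have [//|y0 /=] := eqVneq y 0; rewrite (Defs.valM LF) //; exact: lerD.
Qed.

Lemma valN1 : v (-1) = 0.
Proof.
have N1 : (-1 : F) != 0 by rewrite oppr_eq0 oner_neq0.
have := Defs.valM LF N1 N1; rewrite mulrNN mulr1 val1.
by move=> /esym/eqP; rewrite -mulr2n mulrn_eq0 => /eqP.
Qed.

Lemma vge_opp n x : x \in vge v n -> - x \in vge v n.
Proof.
rewrite !vgeE oppr_eq0; have [//|x0 /=] := eqVneq x 0.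
by rewrite -mulN1r (Defs.valM LF) ?oppr_eq0 ?oner_neq0 // valN1 add0r.
Qed.

Lemma vge_le m n x : m <= n -> x \in vge v n -> x \in vge v m.
Proof. by rewrite !vgeE => le_mn /orP[->//|/(le_trans le_mn) ->]; rewrite orbT. Qed.

(* The proof argument is a phantom: it lets the ring structure of the valuation
   ring, needed for [integralOver], be inferred from the predicate. *)
Definition vring_pred (_ : local_field v q) : {pred F} := valuation_ring v.

Lemma vring_subring : subring_closed (vring_pred LF).
Proof.
split=> [|x y Ax Ay|x y Ax Ay]; first by rewrite /vring_pred /valuation_ring vgeE val1 lexx orbT.
  by apply: (Defs.valD LF) => //; apply: vge_opp.
by have := vge_mul Ax Ay; rewrite addr0.
Qed.

HB.instance Definition _ := GRing.isSubringClosed.Build F (vring_pred LF) vring_subring.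

Record vring := VRing { vring_val : F; _ : vring_val \in vring_pred LF }.

HB.instance Definition _ := [isSub for vring_val].
HB.instance Definition _ := [Choice of vring by <:].
HB.instance Definition _ := [SubChoice_isSubComNzRing of vring by <:].

End Valuation.

(** * The integral closure as a ring *)

Section Integers.
Variables (F : fieldType) (v : F -> int) (q : nat) (E : fieldExtType F).
Hypothesis LF : local_field v q.

Local Notation A := (@base_integers F v E).
Local Notation B := (@integers F v E).

(** Lifting coefficients to [vring LF] makes closure under subtraction and multiplication available
    from [integralOver]. *)
Lemma integersP z : B z <-> integralOver (in_alg E \o (val : vring LF -> F)) z.
Proof.
split=> [[f [f_monic fO fz]]|[f f_monic fz]]; last first.
  exists (map_poly (val : vring LF -> F) f); split.
  - exact: monic_map.
  - rewrite -[valuation_ring v]/(vring_pred LF).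
    by apply/polyOverP => i; rewrite coef_map; apply: (valP f`_i).
  - by rewrite -map_poly_comp.
move: fO; rewrite -[valuation_ring v]/(vring_pred LF) => /polyOverP fO.
pose g := \poly_(i < size f) (insubd 0 f`_i : vring LF).
have gE : map_poly (val : vring LF -> F) g = f.
  apply/polyP => i; rewrite coef_map coef_poly; case: ltnP => [_|le_fi].
    exact: (insubdK (0 : vring LF) (fO i)).
  by rewrite [RHS]nth_default //; exact: (rmorph0 (val : vring LF -> F)).
exists g; last by rewrite map_poly_comp gE.
rewrite monicE; apply/eqP/val_inj.
have <- : lead_coef (map_poly (val : vring LF -> F) g) = val (lead_coef g).
  by apply: lead_coef_map_inj; [exact: val_inj|exact: (rmorph0 (val : vring LF -> F))].
by rewrite gE; apply/eqP.
Qed.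

Lemma integers_subring : subring B.
Proof.
split=> [|x y /integersP xB /integersP yB|x y /integersP xB /integersP yB].
- apply/integersP; exact: integral1.
- by apply/integersP; apply: integral_sub.
- by apply/integersP; apply: integral_mul.
Qed.

Lemma base_integers_sub : A `<=` B.
Proof.
move=> _ [c cO <-]; apply/integersP.
by have := integral_id (in_alg E \o (val : vring LF -> F)) (VRing cO : vring LF).
Qed.

Lemma base_integers_subring : subring A.
Proof.
have [O1 OB OM] := vring_subring LF.
split=> [|_ _ [c cO <-] [d dO <-]|_ _ [c cO <-] [d dO <-]].
- by exists 1; rewrite ?scale1r.
- by exists (c - d); [exact: OB|rewrite scalerBl].
- by exists (c * d); [exact: OM|rewrite -scalerAl mul1r scalerA].
Qed.

End Integers.

(** * The integers of an unramified cubic extension form a cubic pair *)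

Section CubicExtension.
Variables (F : fieldType) (v : F -> int) (q : nat) (pi : F).
Variables (E : fieldExtType F) (R : set E) (f : nat).
Hypotheses (LF : local_field v q) (piP : uniformizer v pi).
Hypotheses (dim3 : \dim {:E} = 3%N) (unr : unramified v E pi).
Hypotheses (R_order : is_order v R) (RB : R `<=` @integers F v E).
Hypothesis conductor : conductor_exponent v pi R f.

Local Notation A := (@base_integers F v E).
Local Notation B := (@integers F v E).
Local Notation p := (pi%:A : E).

Let pi_neq0 : pi != 0. Proof. by case: piP. Qed.
Let v_pi : v pi = 1. Proof. by case: piP. Qed.

Lemma val_pX n : v (pi ^+ n) = n%:Z.
Proof. by rewrite (valX LF) // v_pi -mulr_natr mul1r natz. Qed.

Lemma p_exp n : p ^+ n = (pi ^+ n)%:A.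
Proof. by rewrite -!in_algE rmorphXn. Qed.

Lemma integer_split c : c != 0 -> 0 <= v c ->
  exists n u, [/\ u != 0, v u = 0 & c = pi ^+ n * u].
Proof.
move=> c0 vc; exists `|v c|%N, (c / pi ^+ `|v c|%N).
have pn0 : pi ^+ `|v c|%N != 0 by rewrite expf_neq0.
split; first by rewrite mulf_neq0 // invr_neq0.
  by rewrite (Defs.valM LF) ?invr_neq0 // (valV LF) // val_pX gez0_abs // subrr.
by rewrite mulrC divfK.
Qed.

Let Bring := integers_subring E LF : subring B.
Let Aring := base_integers_subring E LF : subring A.
Let AsubB := base_integers_sub (E := E) LF : A `<=` B.

Lemma B_one : B 1. Proof. by case: Bring. Qed.
Lemma B_prod x y : B x -> B y -> B (x * y).
Proof. by case: Bring => _ _; apply. Qed.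
Lemma B_zero : B 0.
Proof. by rewrite -(subrr 1); case: Bring => B1 BB _; apply: BB. Qed.
Lemma B_sum x y : B x -> B y -> B (x + y).
Proof.
move=> Bx By; rewrite -[y]opprK -[- y]sub0r.
by case: Bring => _ BB _; do 2![apply: (BB) => //]; apply: B_zero.
Qed.

Lemma A_pi n : A (p ^+ n).
Proof.
exists (pi ^+ n); last by rewrite p_exp.
by rewrite /= vgeE val_pX orbC.
Qed.

Lemma B_pi n : B (p ^+ n).
Proof. exact/AsubB/A_pi. Qed.

Lemma p_nz : p != 0.
Proof. by rewrite -in_algE fmorph_eq0. Qed.

Lemma p_nonunit : ~ B p^-1.
Proof.
move=> Bp; have : scale_set p B p by exists 1; rewrite ?mulr1 //; exact: B_one.
by rewrite -unr => -[_]; apply; exists p^-1; rewrite // mulfV ?p_nz.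
Qed.

Lemma unit_or_p z : B z -> (z != 0 /\ B z^-1) \/ scale_set p B z.
Proof.
move=> Bz; have [[y By zy]|nu] := pselect (exists2 y, B y & z * y = 1); last first.
  by right; rewrite -unr.
left; have z0 : z != 0.
  by apply/eqP => z0; move/eqP: zy; rewrite z0 mul0r eq_sym oner_eq0.
by split; rewrite // -[z^-1]mulr1 -zy mulKf.
Qed.

Lemma base_split c : A c -> c != 0 ->
  exists n u, [/\ A u, A u^-1, u != 0 & c = p ^+ n * u].
Proof.
move=> [d dO <-]; rewrite -in_algE fmorph_eq0 => d0.
have [|n [u [u0 vu dE]]] := integer_split d0; first by move: dO; rewrite /= vgeE (negPf d0).
exists n, u%:A; split.
- by exists u; rewrite //= vgeE vu lexx orbT.
- exists u^-1; first by rewrite /= vgeE (valV LF) // vu oppr0 lexx orbT.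
  by rewrite -!in_algE fmorphV.
- by rewrite -in_algE fmorph_eq0.
- by rewrite dE -!in_algE rmorphM rmorphXn.
Qed.

Lemma denominator (z : E) : exists n, B (p ^+ n * z).
Proof.
case: R_order => _ _ _ FR; have : [set: E] z by [].
rewrite -FR => -[n [c [r [cF rR ->]]]]; elim/big_ind: _ => [|x y [m xm] [l yl]|i _].
- by exists 0%N; rewrite mulr0; apply: B_zero.
- exists (m + l)%N; rewrite mulrDr exprD; apply: B_sum.
    by rewrite mulrAC; apply: B_prod => //; apply: B_pi.
  by rewrite -mulrA; apply: B_prod => //; apply: B_pi.
have [d _ dE] := cF i; have Br := RB (rR i).
exists `|v d|%N; rewrite -dE mulrA; apply: B_prod => //; apply: AsubB.
exists (pi ^+ `|v d|%N * d); last by rewrite p_exp -!in_algE rmorphM.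
rewrite /= vgeE; have [->|d0] := eqVneq d 0; first by rewrite mulr0 eqxx.
rewrite (Defs.valM LF) ?expf_neq0 // val_pX.
by rewrite orbC -lerBlDr sub0r ler_normr lexx orbT.
Qed.

(** Dividing by p as long as the cofactor is a nonunit must stop: with p^n z^-1 integral, z = p^(n +
    1) w would make p^-1 = p^n z^-1 w integral. *)
Lemma integers_split z : B z -> z != 0 ->
  exists n u, [/\ B u, B u^-1, u != 0 & z = p ^+ n * u].
Proof.
move=> Bz z0; have [n Bn] := denominator z^-1.
have H k : (exists n u, [/\ B u, B u^-1, u != 0 & z = p ^+ n * u]) \/
    scale_set (p ^+ k) B z.
  elim: k => [|k [?|[u Bu uE]]]; [by right; exists z; rewrite // expr0 mul1r|by left|].
  have [[u0 BVu]|[w Bw wE]] := unit_or_p Bu; first by left; exists k, u.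
  by right; exists w; rewrite // exprSr -mulrA wE.
case: (H n.+1) => // -[w Bw wE]; case: p_nonunit.
have -> : p^-1 = p ^+ n * z^-1 * w; last exact: B_prod.
apply: (mulfI p_nz); rewrite mulfV ?p_nz //.
rewrite (_ : p * _ = p ^+ n.+1 * w * z^-1); last by rewrite exprS; ring.
by rewrite wE mulfV.
Qed.

(** A linear relation exists in dimension 3; dividing it by a coefficient of least valuation makes
    all coefficients integral and one of them 1. *)
Lemma dependent4 (w0 w1 w2 w3 : E) : exists c0 c1 c2 c3,
  [/\ [/\ A c0, A c1, A c2 & A c3],
     c0 * w0 + c1 * w1 + c2 * w2 + c3 * w3 = 0
   & ~ [/\ scale_set p A c0, scale_set p A c1,
           scale_set p A c2 & scale_set p A c3]].
Proof.
pose X := [tuple w0; w1; w2; w3].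
have [k kX [i0 ki0]] : exists2 k : 'I_4 -> F, \sum_i k i *: X`_i = 0 & exists i, k i != 0.
  apply: contrapT => noK.
  have : free X.
    apply/freeP => k kX i; apply: contrapT => /eqP ki; apply: noK.
    by exists k => //; exists i.
  rewrite /free => /eqP X4; have := dimvS (subvf <<X>>%VS).
  by rewrite X4 dim3.
have [i ki i_min] := @Order.TotalTheory.arg_minP _ _ _ i0 (fun i => k i != 0) (fun i => v (k i)) ki0.
pose c j := k j / k i.
have Ac j : A (c j)%:A.
  exists (c j) => //; rewrite /= vgeE /c; have [->|kj] := eqVneq (k j) 0.
    by rewrite mul0r eqxx.
  by rewrite (Defs.valM LF) ?invr_neq0 // (valV LF) // subr_ge0 i_min // orbT.
have sum_c : \sum_j (c j)%:A * X`_j = 0.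
  rewrite -[RHS](scaler0 _ (k i)^-1) -[X in _ = _ *: X]kX scaler_sumr; apply: eq_bigr => j _.
  by rewrite -scalerAl mul1r scalerA mulrC.
pose o := fun n (lt : (n < 4)%N) => Ordinal lt.
exists (c (o 0%N isT))%:A, (c (o 1%N isT))%:A, (c (o 2%N isT))%:A, (c (o 3%N isT))%:A.
split; first by split; apply: Ac.
  rewrite -[RHS]sum_c !big_ord_recl big_ord0 addr0 !addrA.
  by congr (_ + _ + _ + _); congr ((c _)%:A * _); apply: val_inj.
have Ni : ~ scale_set p A (c i)%:A.
  rewrite /c mulfV // scale1r => -[w Aw wE]; apply: p_nonunit.
  have -> : p^-1 = w by apply: (mulfI p_nz); rewrite mulfV ?p_nz.
  exact: AsubB.
have : [\/ i = o 0%N isT, i = o 1%N isT, i = o 2%N isT | i = o 3%N isT].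
  case: (i) => -[|[|[|[|//]]]] lt4.
  - by constructor 1; apply: val_inj.
  - by constructor 2; apply: val_inj.
  - by constructor 3; apply: val_inj.
  - by constructor 4; apply: val_inj.
by case=> <- [].
Qed.

(* A nonzero [F]-linear form [phi] that vanishes on [1] and [x] takes values of
   bounded valuation on [R]; but [B = A + A x + p B] gives
   [B = A + A x + p^(f + 1) B] with [p^f B] inside [R], so that [phi] maps [R]
   into [pi * phi R]. *)
Lemma not_rank2 x : B x -> exists2 w, B w & forall c d w',
  A c -> A d -> B w' -> w <> c + d * x + p * w'.
Proof.
move=> Bx; apply: contrapT => noW.
have span1 w : B w -> exists c d w', [/\ A c, A d, B w' & w = c + d * x + p * w'].
  move=> Bw; apply: contrapT => noC; apply: noW; exists w => // c d w' Ac Ad Bw' wE.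
  by apply: noC; exists c, d, w'.
have [A1 AB AM] := Aring.
have AD y z : A y -> A z -> A (y + z).
  move=> Ay Az; rewrite -[z]opprK; apply: (AB) => //; rewrite -sub0r; apply: (AB) => //.
  by rewrite -(subrr 1); apply: AB.
have spann n w : B w -> exists c d w', [/\ A c, A d, B w' & w = c + d * x + p ^+ n * w'].
  elim: n w => [|n IH] w Bw.
    have [c [d [w' [Ac Ad Bw' wE]]]] := span1 w Bw.
    exists c, d, (p * w'); split=> //; last by rewrite expr0 mul1r.
    by apply: B_prod => //; apply: (B_pi 1).
  have [c [d [w' [Ac Ad Bw' ->]]]] := IH w Bw.
  have [c' [d' [w'' [Ac' Ad' Bw'' ->]]]] := span1 w' Bw'.
  exists (c + p ^+ n * c'), (d + p ^+ n * d'), w''.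
  split=> //; first by apply: AD => //; apply: AM => //; apply: A_pi.
    by apply: AD => //; apply: AM => //; apply: A_pi.
  by rewrite exprSr; ring.
pose U := (<[1]> + <[x]>)%VS : {vspace E}.
have [w0 w0U] : exists w0, w0 \notin U.
  apply: contrapT => allU; have : (fullv <= U)%VS.
    by apply/subvP => w _; apply: contrapT => /negP wU; apply: allU; exists w.
  move/dimvS; rewrite dim3 => le3.
  have := leq_of_leqif (dimv_add_leqif <[1 : E]>%VS <[x]>%VS).
  rewrite !dim_vline => /(leq_trans le3).
  by have := leq_b1 ((1 : E) != 0); have := leq_b1 (x != 0); lia.
(* h kills the span U of 1 and x, and some coordinate of h is nonzero at w0; that coordinate is the
   form phi. *)
pose h w := w - projv U w.
have h0 w : w \in U -> h w = 0 by move=> wU; rewrite /h projv_id ?subrr.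
have hw0 : h w0 != 0.
  rewrite subr_eq0; apply: contraNneq w0U => ->; exact: memv_proj.
have [k hk] : exists k, coord (vbasis fullv) k (h w0) != 0.
  apply: contrapT => noK; case/eqP: hw0.
  rewrite (coord_vbasis (memvf (h w0))) big1 // => k _.
  have [->|ck] := eqVneq (coord (vbasis fullv) k (h w0)) 0; first by rewrite scale0r.
  by case: noK; exists k.
pose phi w := coord (vbasis fullv) k (h w) : F.
have phiD y z : phi (y + z) = phi y + phi z.
  have hD : h (y + z) = h y + h z by rewrite /h (linearD (projv U)) opprD addrACA.
  by rewrite /phi hD linearD.
have phiZ c y : phi (c%:A * y) = c * phi y.
  have hZ : h (c *: y) = c *: h y by rewrite /h linearZ -scalerBr.
  by rewrite /phi -scalerAl mul1r hZ linearZ.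
have phi0 c d : A c -> A d -> phi (c + d * x) = 0.
  move=> [c' _ <-] [d' _ <-]; rewrite /phi h0 ?linear0 //.
  rewrite -scalerAl mul1r; apply: memv_add; apply: memvZ; exact: memv_line.
case: R_order => _ _ [gens RE] FR.
have [m phiR] : exists m : nat, forall r, R r -> phi r \in vge v (- m%:Z).
  have [m mP] : exists m : nat, forall g, g \in gens -> phi g \in vge v (- m%:Z).
    elim: {RE} gens => [|g gens [m mP]]; first by exists 0%N.
    exists (m + `|v (phi g)|)%N => h'; rewrite inE => /orP[/eqP ->|/mP].
      rewrite vgeE; apply/orP; right; lia.
    apply: vge_le; lia.
  exists m => r; rewrite RE => -[n [c [g [cA gP ->]]]].
  elim/big_ind: _ => [|y z|i _].
  - rewrite (_ : phi 0 = 0) ?vge0 //; have := phiZ 0 0; rewrite mulr0 mul0r; exact.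
  - by rewrite phiD; apply: (Defs.valD LF).
  - have [c' c'O <-] := cA i; rewrite phiZ -[- _]add0r; apply: (vge_mul LF) => //.
    exact: mP (gP i).
have phiRn n r : R r -> phi r \in vge v (n%:Z - m%:Z).
  elim: n r => [|n IH] r Rr; first by rewrite sub0r; apply: phiR.
  have [c [d [w [Ac Ad Bw rE]]]] := spann f.+1 r (RB Rr).
  have Rw : R (p ^+ f * w).
    have : scale_set (pi ^+ f)%:A B (p ^+ f) by exists 1; rewrite ?mulr1 ?p_exp //; exact: B_one.
    by rewrite -conductor => -[_]; apply.
  rewrite rE phiD phi0 // add0r exprS -mulrA phiZ.
  have -> : n.+1%:Z - m%:Z = 1 + (n%:Z - m%:Z) by lia.
  apply: (vge_mul LF); last exact: IH.
  by rewrite vgeE v_pi lexx orbT.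
have phiR0 r : R r -> phi r = 0.
  move=> Rr; apply: contrapT => /eqP r0.
  have := phiRn (m + `|v (phi r)| + 1)%N r Rr; rewrite vgeE (negPf r0) /=; lia.
have : [set: E] w0 by [].
rewrite -FR => -[n [c [r [cF rR w0E]]]].
case/eqP: hk; rewrite -[LHS]/(phi w0) w0E.
elim/big_ind: _ => [|y z yE zE|i _].
- by have := phiZ 0 0; rewrite mulr0 mul0r.
- by rewrite phiD yE zE addr0.
- by have [c' _ <-] := cF i; rewrite phiZ phiR0 // mulr0.
Qed.

Lemma integers_cubic_pair : cubic_pair A B p.
Proof.
split; [exact: Aring|exact: Bring|exact: AsubB|exact: (A_pi 1)|exact: p_nonunit
  |exact: base_split|exact: integers_split|exact: denominator|exact: dependent4
  |exact: not_rank2].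
Qed.

Lemma conductor_sub : scale_set (p ^+ f) B `<=` R.
Proof.
move=> z; rewrite p_exp -conductor => -[_ /(_ 1 B_one)]; by rewrite mulr1.
Qed.

Lemma scale_p_base c : scale_set (p ^+ 1) A c%:A <-> c \in vge v 1.
Proof.
split=> [[_ [d dO <-]]|c1].
  rewrite expr1 -!in_algE -rmorphM => /(fmorph_inj (in_alg E)) <-.
  rewrite -[1]addr0; apply: (vge_mul LF) => //; by rewrite vgeE v_pi lexx orbT.
exists (c / pi)%:A; last first.
  by rewrite expr1 -!in_algE -rmorphM mulrC divfK.
exists (c / pi) => //=.
have Vpi : pi^-1 \in vge v (-1) by rewrite vgeE (valV LF) // v_pi lexx orbT.
by have := vge_mul LF c1 Vpi; rewrite subrr.
Qed.

Lemma coset_eq (x y : F) : x - y \in vge v 1 ->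
  [set x + z | z in [set` vge v 1]] `<=` [set y + z | z in [set` vge v 1]].
Proof.
move=> xy _ [z z1 <-]; exists (x - y + z); first exact: (Defs.valD LF).
by rewrite addrA [y + _]addrC subrK.
Qed.

Lemma residue_digits : exists r : nat -> E,
  [/\ forall k, (k < q)%N -> A (r k),
      forall c, A c -> exists2 k, (k < q)%N & scale_set (p ^+ 1) A (c - r k)
    & forall k l, (k < q)%N -> (l < q)%N -> scale_set (p ^+ 1) A (r k - r l) -> k = l].
Proof.
have /pcard_eqP/bijPex[g [g_fun g_inj g_surj]] := residue_card LF.
pose coset x := [set x + z | z in [set` vge v 1]].
have coset_in x : x \in valuation_ring v -> cosets [set` valuation_ring v] [set` vge v 1] (coset x).
  by move=> xO; exists x.
have [|r rP] := @choice _ _ (fun k x => (k < q)%N ->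
    x \in valuation_ring v /\ g (coset x) = k).
  move=> k.
  have [ltkq|] := boolP (k < q)%N; last by exists 0.
  by have [_ [x xO <-] gx] := g_surj k ltkq; exists x.
exists (fun k => (r k)%:A); split=> [k /rP[rO _]|_ [d dO <-]|k l ltk ltl].
- by exists (r k).
- have ltk : (g (coset d) < q)%N by apply: g_fun; apply: coset_in.
  exists (g (coset d)) => //; have [rO gr] := rP _ ltk.
  rewrite -scalerBl; apply/scale_p_base.
  have := g_inj _ _ (mem_set (coset_in _ rO)) (mem_set (coset_in _ dO)) gr => eqC.
  have [z z1 dE] : coset (r (g (coset d))) d.
    by rewrite eqC; exists 0; rewrite ?addr0 //=; exact: vge0.
  by rewrite -[X in X - _]dE addrAC subrr add0r.
- have [rkO gk] := rP k ltk; have [rlO gl] := rP l ltl.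
  rewrite -scalerBl => /scale_p_base kl; rewrite -gk -gl; congr g.
  apply/seteqP; split; apply: coset_eq => //.
  by rewrite -opprB; apply: (vge_opp LF).
Qed.

End CubicExtension.

(** * The number of classes *)

Section Counting.
Variable q : nat.
Hypothesis q_gt1 : (1 < q)%N.

Local Notation Q := (q%:R : rat).

Let Q1 : Q - 1 != 0.
Proof. by rewrite subr_eq0 pnatr_eq1; lia. Qed.

Let Q0 : Q != 0. Proof. by rewrite pnatr_eq0; lia. Qed.

Definition ring_count (a i j : nat) : nat :=
  if (i <= j <= 2 * i)%N then
    ((slope_count q a i j false + slope_count q a i j true) * (1 + (j < 2 * i)))%N
  else 0%N.

Definition column (a j : nat) : nat := (\sum_(0 <= i < j.+1) ring_count a i j)%N.

(** Rings with i > j do not occur, so the sum over i stops at j and a column does not depend on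
    b. *)
Lemma sum_class_count a b :
  (\sum_u @class_count q a b u = \sum_(0 <= j < b.+1) column a j)%N.
Proof.
pose c (i j : 'I_b.+1) k d := class_count q a (i, j, k, d).
transitivity (\sum_(i < b.+1) \sum_(j < b.+1) \sum_(k : bool) \sum_(d : bool) c i j k d)%N.
  by rewrite !pair_big /=; apply: eq_bigr => -[[[i j] k] d] _.
rewrite exchange_big big_mkord; apply: eq_bigr => j _.
transitivity (\sum_(i < b.+1) ring_count a i j)%N.
  apply: eq_bigr => i _; rewrite !big_bool /c /= /ring_count.
  by case: (i <= j <= 2 * i)%N => //=; case: (j < 2 * i)%N; rewrite /=; lia.
rewrite -(big_mkord xpredT (fun i => ring_count a i j)).
rewrite (big_cat_nat (n := j.+1)) //=.
rewrite [X in (_ + X)%N]big_nat [X in (_ + X)%N]big1 ?addn0 // => i /andP[lt_ji _].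
by rewrite /ring_count leqNgt lt_ji.
Qed.

Lemma geometric_sum l u : (l <= u.+1)%N ->
  (\sum_(l <= i < u.+1) Q ^+ (u - i)) * (Q - 1) = Q ^+ (u.+1 - l) - 1.
Proof.
elim: u => [|u IH].
  case: l => [|[|//]] _; first by rewrite big_nat1 !expr0 expr1 mul1r.
  by rewrite big_geq // mul0r subrr.
rewrite leq_eqVlt => /orP[/eqP ->|]; first by rewrite big_geq // mul0r subnn subrr.
rewrite ltnS => le_lu; rewrite big_nat_recr //= subnn expr0.
have -> : \sum_(l <= i < u.+1) Q ^+ (u.+1 - i) = Q * \sum_(l <= i < u.+1) Q ^+ (u - i).
  rewrite mulr_sumr; apply: eq_big_nat => i /andP[_ lt_iu].
  by rewrite -exprS subSn.
rewrite mulrDl -mulrA IH // (subSn le_lu) exprS; ring.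
Qed.

(** The number of points of the projective line over A / p^(j - i), equal to 1 for i = j. *)
Definition line_count j i : rat := Q ^+ (j - i) + (if (i < j)%N then Q ^+ (j - i - 1) else 0).

Lemma sum_line_count l j : (l <= j)%N ->
  (\sum_(l <= i < j.+1) line_count j i) * (Q - 1) = Q ^+ (j.+1 - l) + Q ^+ (j - l) - 2.
Proof.
move=> le_lj; rewrite big_split mulrDl /= geometric_sum ?(leqW le_lj) //.
rewrite big_nat_recr //= ltnn addr0.
have -> : (\sum_(l <= i < j) (if (i < j)%N then Q ^+ (j - i - 1) else 0)) * (Q - 1) =
    Q ^+ (j - l) - 1; last by ring.
case: j le_lj => [|j] le_lj; first by rewrite big_geq // mul0r subrr.
rewrite -geometric_sum //; congr (_ * _); apply: eq_big_nat => i /andP[_ lt_ij].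
by rewrite lt_ij subnAC subn1.
Qed.

(** For j <= a the element p^a x lies in p^j B, so every line is allowed. *)
Lemma ring_count_low a i j : (i <= j <= a)%N -> (j <= 2 * i)%N ->
  (ring_count a i j)%:R = line_count j i * (1 + (j < 2 * i)%N%:R) :> rat.
Proof.
move=> /andP[le_ij le_ja] le_ji; rewrite /ring_count le_ij le_ji /slope_count.
rewrite (leq_trans le_ij le_ja) le_ja andbT (minn_idPl le_ja) natrM natrD /line_count.
by case: ltnP => _; rewrite ?natrX natrD.
Qed.

Lemma column_low_odd a h : (h.*2.+1 <= a)%N ->
  (column a h.*2.+1)%:R * (Q - 1) = 2 * (Q ^+ h.+1 + Q ^+ h - 2).
Proof.
move=> le_a; rewrite /column (big_cat_nat (n := h.+1)) //=; last by lia.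
rewrite big_nat big1 ?add0n => [|i /andP[_ lt_ih]]; last first.
  by rewrite /ring_count [X in _ && X]leqNgt (_ : 2 * i < _)%N ?andbF //; lia.
rewrite natr_sum.
rewrite (@eq_big_nat _ _ _ _ _ _ (fun i => line_count h.*2.+1 i * 2)); last first.
  move=> i /andP[le_hi lt_i]; rewrite ring_count_low; [|lia|lia].
  by rewrite (_ : _ < 2 * i)%N //; lia.
rewrite -mulr_suml mulrAC sum_line_count; last by lia.
have -> : (h.*2.+2 - h.+1 = h.+1)%N by lia.
have -> : (h.*2.+1 - h.+1 = h)%N by lia.
by ring.
Qed.

Lemma column_low0 a : column a 0 = 1%N.
Proof. by rewrite /column big_nat1 /ring_count /slope_count /= min0n. Qed.

(** The self-dual index i = h + 1 counts once, all larger ones twice. The case j = 0 is separate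
    because [line_count] then has a single term. *)
Lemma column_low_even a h : (h.+1.*2 <= a)%N ->
  (column a h.+1.*2)%:R * (Q - 1) = Q ^+ h.+2 + 2 * Q ^+ h.+1 + Q ^+ h - 4.
Proof.
move=> le_a; rewrite /column (big_cat_nat (n := h.+1)) //=; last by lia.
rewrite big_nat big1 ?add0n => [|i /andP[_ lt_ih]]; last first.
  by rewrite /ring_count [X in _ && X]leqNgt (_ : 2 * i < _)%N ?andbF //; lia.
rewrite natr_sum big_ltn; last by lia.
rewrite (@eq_big_nat _ _ _ _ _ _ (fun i => line_count h.+1.*2 i * 2)); last first.
  move=> i /andP[le_hi lt_i]; rewrite ring_count_low; [|lia|lia].
  by rewrite (_ : _ < 2 * i)%N //; lia.
rewrite -mulr_suml mulrDl [_ * 2 * _]mulrAC sum_line_count; last by lia.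
rewrite ring_count_low; [|lia|lia].
rewrite /line_count (_ : h.+1 < h.+1.*2)%N; last by lia.
rewrite (_ : (h.+1.*2 < 2 * h.+1)%N = false); last by lia.
have -> : (h.+1.*2.+1 - h.+2 = h.+1)%N by lia.
have -> : (h.+1.*2 - h.+2 = h)%N by lia.
have -> : (h.+1.*2 - h.+1 = h.+1)%N by lia.
by rewrite subn1 /= !exprS; ring.
Qed.

Lemma ring_count_high a i j : (a < j)%N -> (i <= a)%N -> (j <= 2 * i)%N ->
  (ring_count a i j)%:R = Q ^+ (a - i) * (1 + (j < 2 * i)%N%:R) :> rat.
Proof.
move=> lt_aj le_ia le_ji; have le_ij : (i <= j)%N by lia.
rewrite /ring_count le_ij le_ji /slope_count le_ia (leqNgt j a) lt_aj andbF addn0.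
by rewrite (minn_idPr (ltnW lt_aj)) natrM natrD natrX.
Qed.

Lemma column_high_split a j l : (a < j)%N -> (j <= 2 * a)%N -> l = uphalf j ->
  column a j = (\sum_(l <= i < a.+1) ring_count a i j)%N.
Proof.
move=> lt_aj le_ja lE; rewrite /column (big_cat_nat (n := l)) //=; last by lia.
rewrite big_nat big1 ?add0n => [|i /andP[_ lt_il]]; last first.
  by rewrite /ring_count [X in _ && X]leqNgt (_ : 2 * i < _)%N ?andbF //; lia.
rewrite (big_cat_nat (n := a.+1)) //=; [|lia|lia].
rewrite [X in (_ + X)%N]big_nat [X in (_ + X)%N]big1 ?addn0 // => i /andP[lt_ai lt_ij].
rewrite /ring_count /slope_count (leqNgt i a) lt_ai (leqNgt j a) lt_aj andbF.
by case: ifP.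
Qed.

Lemma column_high_odd a h : (a < h.*2.+1)%N -> (h.*2.+1 <= 2 * a)%N ->
  (column a h.*2.+1)%:R * (Q - 1) = 2 * (Q ^+ (a - h) - 1).
Proof.
move=> lt_a le_a; rewrite (@column_high_split a _ h.+1) //; last by lia.
rewrite natr_sum (@eq_big_nat _ _ _ _ _ _ (fun i => Q ^+ (a - i) * 2)); last first.
  move=> i /andP[le_hi lt_i]; rewrite ring_count_high //; [|lia].
  by rewrite (_ : _ < 2 * i)%N //; lia.
rewrite -mulr_suml mulrAC geometric_sum; last by lia.
by rewrite subSS; ring.
Qed.

Lemma column_high_even a h : (a < h.*2)%N -> (h.*2 <= 2 * a)%N ->
  (column a h.*2)%:R * (Q - 1) = Q ^+ (a - h).+1 + Q ^+ (a - h) - 2.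
Proof.
move=> lt_a le_a; rewrite (@column_high_split a _ h) //; last by lia.
rewrite natr_sum big_ltn; last by lia.
rewrite (@eq_big_nat _ _ _ _ _ _ (fun i => Q ^+ (a - i) * 2)); last first.
  move=> i /andP[le_hi lt_i]; rewrite ring_count_high //; [|lia].
  by rewrite (_ : _ < 2 * i)%N //; lia.
rewrite -mulr_suml mulrDl [_ * 2 * _]mulrAC geometric_sum; last by lia.
rewrite ring_count_high //; [|lia|lia].
rewrite (_ : (h.*2 < 2 * h)%N = false); last by lia.
by rewrite subSS exprS /=; ring.
Qed.

(** Every column with j > 0 has constant term -4 after multiplication by Q - 1, whence 8 h (1 - Q)
    for 2 h columns. Either parity is the induction step for the other. *)
Lemma sum_low a h :
  ((h.*2 <= a)%N -> (\sum_(0 <= j < h.*2.+1) column a j)%N%:R * (Q - 1) ^+ 2 =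
     Q ^+ h.+2 + 4 * Q ^+ h.+1 + 3 * Q ^+ h + (8 * h%:R - 2) * (1 - Q) - 8 * Q) /\
  ((h.*2.+1 <= a)%N -> (\sum_(0 <= j < h.*2.+2) column a j)%N%:R * (Q - 1) ^+ 2 =
     3 * Q ^+ h.+2 + 4 * Q ^+ h.+1 + Q ^+ h + (8 * h%:R + 2) * (1 - Q) - 8 * Q).
Proof.
have odd_step k : ((k.*2 <= a)%N -> (\sum_(0 <= j < k.*2.+1) column a j)%N%:R * (Q - 1) ^+ 2 =
     Q ^+ k.+2 + 4 * Q ^+ k.+1 + 3 * Q ^+ k + (8 * k%:R - 2) * (1 - Q) - 8 * Q) ->
  ((k.*2.+1 <= a)%N -> (\sum_(0 <= j < k.*2.+2) column a j)%N%:R * (Q - 1) ^+ 2 =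
     3 * Q ^+ k.+2 + 4 * Q ^+ k.+1 + Q ^+ k + (8 * k%:R + 2) * (1 - Q) - 8 * Q).
  move=> IH le_a; rewrite big_nat_recr //= natrD mulrDl IH; last by lia.
  rewrite [(Q - 1) ^+ 2]expr2 mulrA column_low_odd // !exprS; ring.
elim: h => [|h [_ IH]].
  split; last apply: odd_step; move=> _; rewrite big_nat1 column_low0 !exprS; ring.
suff H : (h.+1.*2 <= a)%N -> (\sum_(0 <= j < h.+1.*2.+1) column a j)%N%:R * (Q - 1) ^+ 2 =
     Q ^+ h.+3 + 4 * Q ^+ h.+2 + 3 * Q ^+ h.+1 + (8 * h.+1%:R - 2) * (1 - Q) - 8 * Q.
  by split=> //; apply: odd_step.
move=> le_a; rewrite big_nat_recr //= natrD mulrDl.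
rewrite -[h.+1.*2]/(h.*2.+2) IH; last by lia.
rewrite [(Q - 1) ^+ 2]expr2 mulrA -[h.*2.+2]/(h.+1.*2) column_low_even //.
by rewrite -(natr1 h) !exprS; ring.
Qed.

(* The numerator of [class_formula (a + b) b q] after cancelling [Q ^+ b./2]. *)
Definition count_numerator (a b : nat) : rat :=
  (if odd a then 4 * Q ^+ a./2.+2 + 7 * Q ^+ a./2.+1 + Q ^+ a./2
   else Q ^+ a./2.+2 + 7 * Q ^+ a./2.+1 + 4 * Q ^+ a./2)
  + (2 * (a + b)%:R - 2) * (1 - Q) - 8 * Q
  - (if odd b then Q ^+ (a - b./2).+1 + 3 * Q ^+ (a - b./2)
     else 3 * Q ^+ (a - b./2).+1 + Q ^+ (a - b./2)).

(** Induction on b from a. Each column beyond a adds 2 (1 - Q) and a term that telescopes in the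
    last summand of [count_numerator]. With 4 (1 - Q) from each column 1, ..., a this explains the
    coefficient 2 s, as 4 a + 2 (b - a) = 2 (a + b). *)
Lemma sum_column a b : (a <= b <= 2 * a)%N ->
  (\sum_(0 <= j < b.+1) column a j)%N%:R * (Q - 1) ^+ 2 = count_numerator a b.
Proof.
move=> /andP[le_ab]; rewrite -(subnKC le_ab); elim: (b - a)%N => {b le_ab}[|d IH].
  rewrite addn0 => _; rewrite /count_numerator.
  have [[h aE]|[h aE]] : (exists h, a = h.*2) \/ (exists h, a = h.*2.+1).
    by case: (boolP (odd a)) => odda; [right|left]; exists a./2; lia.
    have -> : odd a = false by lia.
    have -> : (a./2 = h)%N by lia.
    have -> : (a - h = h)%N by lia.
    have aQ : a%:R = 2 * h%:R :> rat by rewrite aE -mul2n natrM.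
    by rewrite {1}aE (sum_low a h).1 ?natrD ?aQ ?exprS; [ring|lia].
  have -> : odd a = true by lia.
  have -> : (a./2 = h)%N by lia.
  have -> : (a - h = h.+1)%N by lia.
  have aQ : a%:R = 2 * h%:R + 1 :> rat by rewrite aE -natr1 -mul2n natrM.
  by rewrite {1}aE (sum_low a h).2 ?natrD ?aQ ?exprS; [ring|lia].
rewrite addnS => le_d; rewrite big_nat_recr //= natrD mulrDl IH; last by lia.
rewrite [(Q - 1) ^+ 2]expr2 mulrA.
set b := (a + d)%N in le_d *; rewrite /count_numerator addnS -natr1.
have [[h bE]|[h bE]] : (exists h, b = h.*2) \/ (exists h, b = h.*2.+1).
  by case: (boolP (odd b)) => oddb; [right|left]; exists b./2; lia.
  have -> : odd b = false by lia.
  have -> : odd b.+1 = true by lia.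
  have -> : (b./2 = h)%N by lia.
  have -> : (b.+1./2 = h)%N by lia.
  have -> : column a b.+1 = column a h.*2.+1 by rewrite bE.
  rewrite column_high_odd; [|lia|lia].
  by rewrite !exprS; ring.
have -> : odd b = true by lia.
have -> : odd b.+1 = false by lia.
have -> : (b./2 = h)%N by lia.
have -> : (b.+1./2 = h.+1)%N by lia.
have -> : column a b.+1 = column a h.+1.*2 by rewrite bE.
rewrite column_high_even; [|lia|lia].
have -> : (a - h = (a - h.+1).+1)%N by lia.
by rewrite !exprS; ring.
Qed.

(** The denominator carries Q^(b./2) for either parity of b, and Q^(s - f) = Q^a = Q^(a - b./2)
    Q^(b./2), so this power cancels. The parities of a and b correspond to the four cases in s and
    f. *)
Lemma class_formula_numerator a b : (a <= b <= 2 * a)%N ->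
  class_formula (a + b) b q = count_numerator a b / (Q - 1) ^+ 2.
Proof.
move=> /andP[le_ab le_ba]; rewrite /class_formula /count_numerator.
have -> : (a + b)%N%:Z - b%:Z = a%:Z by lia.
have -> : a%:Z + 1 = a.+1%:Z by lia.
set g := a./2; set h := b./2; set e := (a - h)%N.
have Qa : Q ^+ a = Q ^+ e * Q ^+ h by rewrite -exprD subnK //; lia.
have Yn0 : Q ^+ h != 0 by rewrite expf_neq0.
rewrite -!exprnP !(exprS Q a) Qa.
have [oa|oa] := boolP (odd a); have [ob|ob] := boolP (odd b).
- have -> : odd (a + b) = false by lia.
  have -> : b.-1./2 = h by lia.
  have -> : ((b + 1)./2 = h.+1)%N by lia.
  have -> : (a + b)./2%:Z - 1 = (g + h)%N%:Z by lia.
  have -> : ((a + b)./2 = (g + h).+1)%N by lia.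
  by rewrite -exprnP addn1 !exprS !exprD; field; rewrite Yn0 Q1.
- have -> : odd (a + b) = true by lia.
  have -> : ((a + b + 3)./2 = (g + h).+2)%N by lia.
  have -> : ((a + b + 1)./2 = (g + h).+1)%N by lia.
  have -> : ((a + b).-1./2 = g + h)%N by lia.
  by rewrite addn1 !exprS !exprD; field; rewrite Yn0 Q1.
- have -> : odd (a + b) = true by lia.
  have -> : ((a + b + 3)./2 = (g + h).+2)%N by lia.
  have -> : ((a + b + 1)./2 = (g + h).+1)%N by lia.
  have -> : ((a + b).-1./2 = g + h)%N by lia.
  have -> : b.-1./2 = h by lia.
  have -> : ((b + 1)./2 = h.+1)%N by lia.
  by rewrite !exprS !exprD; field; rewrite Yn0 Q1.
- have -> : odd (a + b) = false by lia.
  have -> : ((a + b)./2 = g + h)%N by lia.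
  by rewrite addn1 addn2 !exprS !exprD; field; rewrite Yn0 Q1.
Qed.

Lemma sum_class_count_formula a b : (a <= b <= 2 * a)%N ->
  (\sum_u @class_count q a b u)%N%:R = class_formula (a + b) b q.
Proof.
move=> abP; rewrite sum_class_count class_formula_numerator // -sum_column //.
by rewrite mulfK // expf_neq0.
Qed.

End Counting.

Theorem theorem4p6 :
  exists Phi : nat -> nat -> nat -> nat,
  forall (F : fieldType) (v : F -> int) (q : nat) (pi : F)
         (E : fieldExtType F) (R : set E) (s f : nat),
    local_field v q ->
    uniformizer v pi ->
    \dim {:E} = 3%N ->
    unramified v E pi ->
    is_order v R ->
    colength v R s ->
    conductor_exponent v pi R f ->
    ideal_class_monoid R #= `I_(Phi s f q) /\
    (Phi s f q)%:R = class_formula s f q.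
Proof.
(* Since s = a + b and f = b, the exponent a is s - f; [class_count] refers to no field, so the
   value depends on s, f and q alone. *)
exists (fun s f q => (\sum_u @class_count q (s - f) f u)%N).
move=> F v q pi E R s f LF piP dim3 unr R_order Rlen Rcond.
have [[Rring AR Rfg FR] [[L Lchain] _]] := (R_order, Rlen).
have RB : R `<=` @integers F v E.
  by have [<- <- _ _] := Lchain; apply: (chain_le Lchain); rewrite leqnn.
have AB := integers_cubic_pair LF piP dim3 unr R_order RB Rcond.
have [r [rA r_ex r_inj]] := residue_digits E LF piP.
have TP := digit_system_ex AB rA r_ex r_inj.
have [a [b [x [xP abP RE]]]] := order_lattice AB Rring AR RB (conductor_sub LF Rcond).
have le_ab : (a <= b)%N by case/andP: abP.
have bf : b = f.
  by apply: (lattice_conductor_eq AB xP le_ab); rewrite -RE Rcond p_exp.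
have sE : s = (a + b)%N by apply: (lattice_length AB xP le_ab); rewrite -RE.
subst f s; rewrite addnK; split.
  by rewrite RE; apply: (ideal_class_monoid_card AB TP xP abP).
by apply: sum_class_count_formula => //; apply: (digit_system_base AB TP).
Qed.
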